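(* Let $n,N\ge1$ be integers. For each $i\in[N]=\{1,\dots,N\}$ let $f_i:\mathbb{R}^n\to\mathbb{R}$ be a locally Lipschitz continuous path-differentiable function admitting $\mathcal{D}_{f_i}:\mathbb{R}^n\rightrightarrows\mathbb{R}^n$ as a conservative field. Put $f=\frac1N\sum_{i=1}^Nf_i$ and $\mathcal{D}_f(x)=\mathrm{conv}\big(\frac1N\sum_{i=1}^N\mathcal{D}_{f_i}(x)\big)$. Assume that $\{f(x):0\in\mathcal{D}_f(x)\}$ has empty interior in $\mathbb{R}$ and that $f$ is bounded from below on $\mathbb{R}^n$. Let $\{x_k\}_{k\ge0}$ be generated by the learning-rate-free momentum SGD (LFM), as described in the context, with parameters $\varepsilon_0>0$, $\rho>0$, $\beta\in[0,1)$ and initial momentum $m_0\in\mathbb{R}^n$, and with $\mu_k>0$ for all $k\ge0$. Suppose there is a constant $M>0$ such that $\sup_{k\ge0}\|x_k\|\le M$ almost surely. Then almost surely, any cluster point of $\{x_k\}$ lies in $\{x\in\mathbb{R}^n:0\in\mathcal{D}_f(x)\}$, and the sequence $\{f(x_k)\}$ converges.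
   Context: LFM. Let $\bar x\in\mathbb{R}^n$ be the reference (initial) point from which distances are measured, $x_0$ the first iterate and $m_0$ the initial momentum. In each epoch $i=0,1,2,\dots$ a random permutation $(\pi_{i,0},\dots,\pi_{i,N-1})$ of $[N]$ is sampled. For $k=iN+j$ with $0\le j\le N-1$ (step $j$ of epoch $i$): $$g_k\in\mathcal{D}_{f_{\pi_{i,j}}}(x_k),\quad \mu_k=\rho\max_{0\le l\le k}\|x_l-\bar x\|,\quad \eta_k=\frac{\mu_k}{\sqrt{\varepsilon_0+\sum_{l=0}^k\|m_l\|^2}},$$ $$m_{k+1}=\beta m_k+(1-\beta)g_k,\quad x_{k+1}=x_k-\eta_km_{k+1}.$$ Definitions. $\|\cdot\|$ is the Euclidean norm; $\mathrm{conv}$ the convex hull; sums of sets are Minkowski sums. A set-valued mapping $\mathcal{D}:\mathbb{R}^n\rightrightarrows\mathbb{R}^n$ is graph-closed if $\{(x,d):d\in\mathcal{D}(x)\}$ is closed, and locally bounded if $\sup_{x\in K,d\in\mathcal{D}(x)}\|d\|<\infty$ for every compact $K$. For $h:\mathbb{R}^n\to\mathbb{R}$ locally Lipschitz and $\mathcal{D}$ graph-closed and locally bounded, $\mathcal{D}$ is a conservative field for $h$ (and $h$ is a potential function for $\mathcal{D}$) if for every $x$ and every absolutely continuous curve $\gamma$ with $\gamma(0)=0,\gamma(1)=x$, $h(x)=h(0)+\int_0^1\sup_{l\in\mathcal{D}(\gamma(s))}\langle l,\dot\gamma(s)\rangle ds$ (with $\sup\emptyset=-\infty$, so the values of $\mathcal{D}$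 are necessarily nonempty). $h$ is path-differentiable if it is a potential function for some conservative field. *)

(* Defs.v *)
From HB Require Import structures.
From mathcomp Require Export all_boot all_order all_algebra all_fingroup.
From mathcomp Require Export all_classical all_reals all_analysis.
Export Order.TTheory GRing.Theory Num.Theory.
Export numFieldNormedType.Exports.

Set Implicit Arguments.
Unset Strict Implicit.
Unset Printing Implicit Defensive.

Local Open Scope classical_set_scope.
Local Open Scope ring_scope.

Section Euclidean.
Variables (R : realType) (n : nat).
Implicit Types u v : 'rV[R]_n.

Definition dotv u v : R := \sum_(i < n) u 0 i * v 0 i.

(* The library norm on ['rV[R]_n] is the sup norm; it induces the same topology
   as this one, so [closed], [compact], [cluster] etc. are used unchanged. *)
Definition norm2 u : R := Num.sqrt (dotv u u).

Definition convex_hull (A : set 'rV[R]_n) : set 'rV[R]_n :=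
  smallest (fun B : set 'rV[R]_n => @convex_set R 'rV[R]_n B) A.

Definition minkowski_sum (N : nat) (A : 'I_N -> set 'rV[R]_n) : set 'rV[R]_n :=
  [set \sum_(i < N) a i | a in [set a : 'I_N -> 'rV[R]_n | forall i, A i (a i)]].

End Euclidean.

Section ConservativeField.
Variables (R : realType) (n : nat).
Implicit Types (h : 'rV[R]_n -> R) (D : 'rV[R]_n -> set 'rV[R]_n).

Definition locally_lipschitz h : Prop :=
  forall x : 'rV[R]_n, exists2 U, nbhs x U &
    exists L : R, forall y z, U y -> U z -> `|h y - h z| <= L * norm2 (y - z).

Definition graph_closed D : Prop :=
  closed [set p : 'rV[R]_n * 'rV[R]_n | D p.1 p.2].

Definition locally_bounded D : Prop :=
  forall K : set 'rV[R]_n, compact K ->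
    (ereal_sup [set (norm2 d)%:E | d in \bigcup_(x in K) D x] < +oo)%E.

(* Absolute continuity on [0, 1]: the curve is a total function on [R], whose
   values outside [0, 1] are irrelevant. *)
Definition absolutely_continuous01 (gamma : R -> 'rV[R]_n) : Prop :=
  forall e : R, 0 < e -> exists2 d : R, 0 < d &
    forall (p : nat) (a b : 'I_p -> R),
      (forall i, [/\ 0 <= a i, a i <= b i & b i <= 1]) ->
      trivIset setT (fun i : 'I_p => `]a i, b i[%classic) ->
      \sum_(i < p) (b i - a i) < d ->
      \sum_(i < p) norm2 (gamma (b i) - gamma (a i)) < e.

(* The equation is in [\bar R]: it forces the integral to be finite.
   [ereal_sup set0 = -oo], and [derive1 gamma] takes an arbitrary value on the null
   set where [gamma] is not differentiable. *)
Definition conservative_field D h : Prop :=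
  [/\ locally_lipschitz h, graph_closed D, locally_bounded D &
    forall (x : 'rV[R]_n) (gamma : R -> 'rV[R]_n),
      absolutely_continuous01 gamma -> gamma 0 = 0 -> gamma 1 = x ->
      ((h x)%:E = (h 0)%:E +
        \int[lebesgue_measure]_(s in `[0%R, 1%R])
          ereal_sup [set (dotv l (derive1 gamma s))%:E | l in D (gamma s)])%E].

Definition path_differentiable h : Prop := exists D, conservative_field D h.

End ConservativeField.

Section FiniteSum.
Variables (R : realType) (n N : nat).

Definition mean_fun (f : 'I_N -> 'rV[R]_n -> R) (x : 'rV[R]_n) : R :=
  N%:R^-1 * \sum_(i < N) f i x.

Definition mean_field (D : 'I_N -> 'rV[R]_n -> set 'rV[R]_n)
    (x : 'rV[R]_n) : set 'rV[R]_n :=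
  convex_hull [set N%:R^-1 *: d | d in minkowski_sum (fun i => D i x)].

Definition stationary (D : 'rV[R]_n -> set 'rV[R]_n) : set 'rV[R]_n :=
  [set x | D x 0].

End FiniteSum.

Section LFM.
Variables (R : realType) (n N : nat).
Implicit Types x m g : nat -> 'rV[R]_n.

(* The terms are nonnegative, so the neutral element 0 does not affect the
   maximum. *)
Definition lfm_mu (rho : R) (xbar : 'rV[R]_n) x (k : nat) : R :=
  rho * \big[Num.max/0]_(l < k.+1) norm2 (x l - xbar).

Definition lfm_eta (rho eps0 : R) (xbar : 'rV[R]_n) x m (k : nat) : R :=
  lfm_mu rho xbar x k / Num.sqrt (eps0 + \sum_(l < k.+1) norm2 (m l) ^+ 2).

(* One realization of the method; [pi i] is the permutation used in epoch [i].
   The first iterate [x 0] is left arbitrary. *)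
Definition lfm (D : 'I_N -> 'rV[R]_n -> set 'rV[R]_n) (eps0 rho beta : R)
    (xbar m0 : 'rV[R]_n) (pi : nat -> 'S_N) x m g : Prop :=
  [/\ m 0%N = m0,
      forall (i : nat) (j : 'I_N),
        D (pi i j) (x (i * N + j)%N) (g (i * N + j)%N),
      forall k, m k.+1 = beta *: m k + (1 - beta) *: g k &
      forall k, x k.+1 = x k - lfm_eta rho eps0 xbar x m k *: m k.+1].

End LFM.

(* Main.v *)
From HB Require Import structures.
Require Import Defs.
From mathcomp Require Import measurable_realfun lra ring zify.

Set Implicit Arguments.
Unset Strict Implicit.
Unset Printing Implicit Defensive.

Local Open Scope classical_set_scope.
Local Open Scope ring_scope.

(* The statement holds for every realization whose iterates are bounded.  If the
   squared momenta are summable then g tends to 0, and every cluster point is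
   critical for each f_i.  Otherwise the step sizes tend to 0 with bounded
   variation and divergent sum; Abel summation then shows that neither the
   momentum nor the reshuffling matters in the limit.  Taking, along an
   ultrafilter of starting indices, the pointwise limit of the iterates reached
   after elapsed step-size time t gives a Lipschitz curve z with
   <-z'(t), u> <= (1/N) sum_i sup <D_i(z(t)), u> for all u.  The conservative
   field identity along the time reversal of z yields
   f(z(0)) - f(z(T)) >= \int_0^T |z'|^2, so if f(z(T)) >= f(z(0)) then z' = 0
   almost everywhere and 0 is in D_f(z(0)).  An upcrossing argument at a
   noncritical value gives the convergence of f(x_k). *)

(** * Inner product, sup norm and ultrafilter limits *)

(** The identity of a conservative field only controls suprema of products with the derivative of
    the curve. Testing the velocity bound for [-z'] with [u = z'] gives merely a lower bound by
    [-|z'|^2] for such a supremum; after time reversal [-z'] is itself the direction of the curve,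
    and the same bound becomes dissipation. Differential inclusions are replaced throughout by
    scalar inequalities between support functions. These pass to limits by upper semicontinuity and
    ignore convexification; a convex hull appears only at the end, when 0 has to be placed in
    [mean_field D y]. An ultrafilter yields all the limits z(t) at once, without Arzela-Ascoli or
    weak compactness of derivatives. Convergence of f(x_k) is not yet known when criticality is
    proved. The key step therefore concerns limit points from which f does not drop at once: this
    holds at upcrossings of a level and, once f(x_k) converges, at every cluster point. *)

Section DotProduct.
Variables (R : realType) (n : nat).
Implicit Types u v w : 'rV[R]_n.

Lemma dotvC u v : dotv u v = dotv v u.
Proof. by apply: eq_bigr => i _; rewrite mulrC. Qed.

Lemma dotvDl u v w : dotv (u + v) w = dotv u w + dotv v w.
Proof. by rewrite -big_split; apply: eq_bigr => i _; rewrite mxE mulrDl. Qed.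

Lemma dotvZl a u v : dotv (a *: u) v = a * dotv u v.
Proof. by rewrite mulr_sumr; apply: eq_bigr => i _; rewrite mxE mulrA. Qed.

Lemma dotvNl u v : dotv (- u) v = - dotv u v.
Proof. by rewrite -scaleN1r dotvZl mulN1r. Qed.

Lemma dotvDr u v w : dotv w (u + v) = dotv w u + dotv w v.
Proof. by rewrite dotvC dotvDl !(dotvC w). Qed.

Lemma dotvZr a u v : dotv u (a *: v) = a * dotv u v.
Proof. by rewrite dotvC dotvZl dotvC. Qed.

Lemma dotvNr u v : dotv u (- v) = - dotv u v.
Proof. by rewrite dotvC dotvNl dotvC. Qed.

Lemma dotvBr u v w : dotv w (u - v) = dotv w u - dotv w v.
Proof. by rewrite dotvDr dotvNr. Qed.

Lemma dot0v v : dotv 0 v = 0.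
Proof. by rewrite -(scale0r v) dotvZl mul0r. Qed.

Lemma dotv0 v : dotv v 0 = 0.
Proof. by rewrite dotvC dot0v. Qed.

Lemma dotv_suml (I : Type) (r : seq I) (P : pred I) (F : I -> 'rV[R]_n) v :
  dotv (\sum_(i <- r | P i) F i) v = \sum_(i <- r | P i) dotv (F i) v.
Proof.
by elim/big_rec2: _ => [|i x y _ <-]; [exact: dot0v | rewrite dotvDl].
Qed.

Lemma dotvv_ge0 u : 0 <= dotv u u.
Proof. by apply: sumr_ge0 => i _; rewrite -expr2 sqr_ge0. Qed.

Lemma dotvv_eq0 u : dotv u u = 0 -> u = 0.
Proof.
move=> /eqP; rewrite psumr_eq0 => [/allP h|i _]; last by rewrite -expr2 sqr_ge0.
apply/rowP => i; rewrite mxE.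
by have := h i (mem_index_enum _); rewrite /= -expr2 sqrf_eq0 => /eqP.
Qed.

Lemma norm_coord u i : `|u 0 i| <= `|u|.
Proof.
rewrite [leRHS]/Num.norm /= mx_normrE.
by apply: (le_bigmax _ (fun ij : 'I_1 * 'I_n => `|u ij.1 ij.2|) (0, i)).
Qed.

Lemma norm_le_coord u (C : R) : 0 <= C -> (forall i, `|u 0 i| <= C) -> `|u| <= C.
Proof.
move=> C0 h; rewrite [leLHS]/Num.norm /= mx_normrE.
by apply/bigmax_leP; split => // -[i j] _ /=; rewrite ord1.
Qed.

Lemma norm_le_norm2 u : `|u| <= norm2 u.
Proof.
apply: norm_le_coord; first exact: sqrtr_ge0.
move=> i; rewrite -sqrtr_sqr; apply: ler_wsqrtr.
rewrite /dotv (bigD1 i) //= expr2 lerDl.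
by apply: sumr_ge0 => j _; rewrite -expr2 sqr_ge0.
Qed.

Lemma dotv_le u v : `|dotv u v| <= n%:R * `|u| * `|v|.
Proof.
apply: (le_trans (ler_norm_sum _ _ _)).
rewrite -mulrA mulr_natl -[X in _ *+ X](card_ord n) -sumr_const.
by apply: ler_sum => i _; rewrite normrM ler_pM ?normr_ge0 ?norm_coord.
Qed.

Lemma norm2_ge0 u : 0 <= norm2 u.
Proof. exact: sqrtr_ge0. Qed.

Lemma sqr_norm2 u : norm2 u ^+ 2 = dotv u u.
Proof. by rewrite sqr_sqrtr ?dotvv_ge0. Qed.

Lemma norm2_le_norm u : norm2 u <= n%:R * `|u|.
Proof.
rewrite -ler_sqr ?nnegrE ?norm2_ge0 ?mulr_ge0 ?normr_ge0 ?ler0n//.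
rewrite sqr_norm2 (le_trans (ler_norm _))// (le_trans (dotv_le _ _))//.
rewrite -mulrA -expr2 exprMn ler_wpM2r ?sqr_ge0//.
by rewrite -natrX ler_nat -mulnn; case: (n) => // k; rewrite leq_pmulr.
Qed.

Lemma cvg_rowP (T : Type) (F : set_system T) {FF : Filter F}
    (h : T -> 'rV[R]_n) (l : 'rV[R]_n) :
  (h t @[t --> F] --> l) <-> forall i, h t 0 i @[t --> F] --> l 0 i.
Proof.
split=> [hl i|hl].
  exact: (cvg_comp _ _ hl (@coord_continuous R 1 n 0 i l)).
apply/cvgrPdist_le => e e0.
have /filter_forall : forall i, \forall t \near F, `|l 0 i - h t 0 i| <= e.
  by move=> i; move/cvgrPdist_le : (hl i); exact.
apply: filterS => t ht; apply: norm_le_coord; first exact: ltW.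
by move=> i; rewrite !mxE.
Qed.

Lemma cvg_dotv (T : Type) (F : set_system T) {FF : Filter F}
    (g h : T -> 'rV[R]_n) (a b : 'rV[R]_n) :
  g t @[t --> F] --> a -> h t @[t --> F] --> b ->
  dotv (g t) (h t) @[t --> F] --> dotv a b.
Proof.
move=> /cvg_rowP ga /cvg_rowP hb.
by apply: cvg_big => [|i _]; [exact: add_continuous | exact: cvgM].
Qed.

End DotProduct.

Section Ultrafilters.

Lemma ultra_fmap (S T : Type) (u : S -> T) (F : set_system S) :
  UltraFilter F -> UltraFilter (u @ F).
Proof.
move=> UF; split; first exact: fmap_proper_filter.
move=> G PG FG; apply/seteqP; split => // A GA.
have [//|FnA] := in_ultra_setVsetC (u @^-1` A) UF.
have : G (A `&` ~` A) by apply: filterI => //; exact: FG.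
by rewrite setICr => /filter_ex[].
Qed.

(** Closed balls of the sup norm are compact. No subsequence is extracted, so a single ultrafilter
    serves an uncountable family of sequences at once. *)
Lemma ultra_cvg_bounded (R : realType) (n : nat) (T : Type) (F : set_system T)
    (u : T -> 'rV[R]_n) (C : R) : UltraFilter F ->
  (\forall t \near F, `|u t| <= C) ->
  exists2 l : 'rV[R]_n, u t @[t --> F] --> l & `|l| <= C.
Proof.
move=> UF uC.
have cC : closed [set x : 'rV[R]_n | `|x| <= C].
  apply: (@closed_comp _ _ (fun x : 'rV[R]_n => `|x|) [set r : R | r <= C]).
    by move=> x _; exact: norm_continuous.
  exact: closed_le.
have bC : bounded_set [set x : 'rV[R]_n | `|x| <= C].
  exists C; split; first exact: num_real.
  by move=> D CD x /= /le_trans; apply; exact: ltW.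
have := bounded_closed_compact bC cC; rewrite compact_ultra.
by move=> /(_ _ (ultra_fmap u UF) uC) [l [/= lC ul]]; exists l.
Qed.

Lemma ultra_oo : exists2 U : set_system nat, UltraFilter U & \oo `<=` U.
Proof.
have [U [UU ooU]] := ultraFilterLemma (eventually_filter).
by exists U.
Qed.

End Ultrafilters.

(** * Support functions of graph-closed fields *)

Section SupportFunction.
Variables (R : realType) (n : nat).
Implicit Types (A : set 'rV[R]_n) (D : 'rV[R]_n -> set 'rV[R]_n)
  (x y l u v : 'rV[R]_n).

(** Real-valued support function. The real [sup] takes a default value on empty or unbounded sets,
    hence the nonemptiness and norm bounds that accompany it below. *)
Definition sup_dot A u : R := sup [set dotv l u | l in A].

Lemma has_ubound_dot A u (C : R) : (forall l, A l -> `|l| <= C) ->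
  has_ubound [set dotv l u | l in A].
Proof.
move=> bA; exists (n%:R * C * `|u|) => _ [l Al <-].
rewrite (le_trans (ler_norm _))// (le_trans (dotv_le _ _))//.
by rewrite ler_wpM2r// ler_wpM2l// bA.
Qed.

Lemma le_sup_dot A u (C : R) l : (forall l, A l -> `|l| <= C) -> A l ->
  dotv l u <= sup_dot A u.
Proof.
by move=> bA Al; apply: ub_le_sup; [exact: has_ubound_dot bA | exists l].
Qed.

Lemma sup_dot_le A u (c : R) : A !=set0 -> (forall l, A l -> dotv l u <= c) ->
  sup_dot A u <= c.
Proof.
move=> [l Al] h; apply: ge_sup; first by exists (dotv l u), l.
by move=> _ [k Ak <-]; exact: h.
Qed.

Lemma locally_bounded_ball D (r : R) : locally_bounded D ->
  exists2 C : R, 0 <= C & forall x l, `|x| <= r -> D x l -> `|l| <= C.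
Proof.
move=> lb.
have cK : compact [set x : 'rV[R]_n | `|x| <= r].
  apply: bounded_closed_compact.
    exists r; split; first exact: num_real.
    by move=> D' CD x /= /le_trans; apply; exact: ltW.
  apply: (@preimage_closed _ _ (fun x : 'rV[R]_n => `|x|) [set s : R | s <= r]).
    by move=> x _; exact: norm_continuous.
  exact: closed_le.
have := lb _ cK; set S := ereal_sup _ => Soo.
exists (Num.max 0 (fine S)); first by rewrite le_max lexx.
move=> x l xr Dl; rewrite le_max; apply/orP; right.
have lS : ((norm2 l)%:E <= S)%E.
  by apply: ereal_sup_ubound; exists l => //; exists x.
apply: (le_trans (norm_le_norm2 l)).
rewrite -lee_fin fineK // fin_numElt Soo andbT.
by apply: lt_le_trans lS; exact: ltNyr.
Qed.

Lemma graph_closed_cvg (T : Type) (F : set_system T) {FF : ProperFilter F} D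
    (y l : T -> 'rV[R]_n) (y0 l0 : 'rV[R]_n) : graph_closed D ->
  y t @[t --> F] --> y0 -> l t @[t --> F] --> l0 ->
  (\forall t \near F, D (y t) (l t)) -> D y0 l0.
Proof.
move=> cD yy0 ll0 Dyl.
have cyl : (y t, l t) @[t --> F] --> (y0, l0)
  by apply: (@cvg_pair T _ _ F (nbhs y0) (nbhs l0) _ _ _ y l yy0 ll0).
exact: (@closed_cvg _ _ F FF (fun t => (y t, l t))
  (fun p : 'rV[R]_n * 'rV[R]_n => D p.1 p.2) cD Dyl (y0, l0) cyl).
Qed.

(** Joint upper semicontinuity in the point and the direction. Selections along a violating sequence
    are bounded; their ultrafilter limit lies in [D x] by graph closedness, but its product with [u]
    is too large. Quantifying over [l] allows [D y] to be empty. *)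
Lemma sup_dot_usc D x u (e : R) : graph_closed D -> locally_bounded D -> 0 < e ->
  exists2 d : R, 0 < d & forall y v, `|y - x| < d -> `|v - u| < d ->
    forall l, D y l -> dotv l v <= sup_dot (D x) u + e.
Proof.
move=> cD lbD e0; apply: contrapT => nex.
have /choice[s sP] : forall k : nat, exists p : 'rV[R]_n * 'rV[R]_n * 'rV[R]_n,
    [/\ `|p.1.1 - x| < k.+1%:R^-1, `|p.1.2 - u| < k.+1%:R^-1, D p.1.1 p.2 &
        sup_dot (D x) u + e < dotv p.2 p.1.2].
  move=> k; apply: contrapT => nk; apply: nex; exists k.+1%:R^-1.
    by rewrite invr_gt0 ltr0n.
  move=> y v yx vu l Dl; rewrite leNgt; apply/negP => lt.
  by apply: nk; exists (y, v, l).
have [U UU ooU] := ultra_oo.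
have cvgU (p : nat -> 'rV[R]_n) (a : 'rV[R]_n) :
    (forall k, `|p k - a| < k.+1%:R^-1) -> p k @[k --> U] --> a.
  move=> pa; have ca : p k @[k --> \oo] --> a.
    apply/cvgrPdist_le => _/posnumP[r]; near=> k.
    rewrite distrC (le_trans (ltW (pa k)))// ltW//.
    by near: k; exact: near_infty_natSinv_lt.
  by move=> A /ca; exact: ooU.
have yx : (s k).1.1 @[k --> U] --> x by apply: cvgU => k; have [] := sP k.
have vu : (s k).1.2 @[k --> U] --> u by apply: cvgU => k; have [] := sP k.
have [C _ DC] := locally_bounded_ball (`|x| + 1) lbD.
have lC k : `|(s k).2| <= C.
  have [ykx _ Dk _] := sP k; apply: DC Dk.
  rewrite -[(s k).1.1](subrK x) (le_trans (ler_normD _ _))// addrC lerD2l.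
  by rewrite (le_trans (ltW ykx))// invf_le1 ?ltr0n// ler1n.
have {}lC : \forall k \near U, `|(s k).2| <= C by exact: nearW.
have [l ll _] := ultra_cvg_bounded UU lC.
have Dl : D x l.
  by apply: (graph_closed_cvg cD yx ll); apply: nearW => k; have [] := sP k.
have : sup_dot (D x) u + e <= dotv l u.
  apply: cvgr_to_ge (cvg_dotv ll vu) _.
  by apply: nearW => k; have [_ _ _ /ltW] := sP k.
have := @le_sup_dot (D x) u C l.
have {}DC k : D x k -> `|k| <= C by apply: DC; rewrite lerDl.
move=> /(_ DC Dl); lra.
Unshelve. all: by end_near. Qed.

End SupportFunction.

(** * Lipschitz curves *)

Section StieltjesLipschitz.
Context {R : realType}.
Variables (F : cumulative R R) (L : R).
Hypothesis F_lip : forall x y, x <= y -> F y - F x <= L * (y - x).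
Local Notation nu := (lebesgue_stieltjes_measure F).
Local Notation lambda := (@lebesgue_measure R).

Lemma stieltjes_oc (a b : R) : a <= b -> nu `]a, b] = (F b - F a)%:E.
Proof.
move=> ab; rewrite /lebesgue_stieltjes_measure /measure_extension.
by rewrite measurable_mu_extE/= ?wlength_itv_bnd//; exact: is_ocitv.
Qed.

(** The comparison is between outer measures, cover by cover: a half-open interval has [F]-length at
    most [L] times its length. *)
Lemma stieltjes_null (A : set R) : 0 < L -> lambda A = 0%E -> nu A = 0%E.
Proof.
move=> L0 A0; apply/eqP; rewrite eq_le measure_ge0 andbT.
suff : ((L^-1)%:E * nu A <= lambda A)%E.
  by rewrite A0 pmule_rle0// lte_fin invr_gt0.
apply: le_ereal_inf_tmp => _ [c [mc Ac] <-].
rewrite lee_pdivrMl//.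
apply: (@le_trans _ _ (\sum_(k <oo) wlength F (c k))%E).
  by apply: ereal_inf_lbound; exists c.
rewrite -nneseriesZl; last by move=> i _; exact: wlength_ge0.
apply: lee_nneseries => k *; first exact: wlength_ge0.
have [[a b] _ <-] : ocitv (c k) := mc k.
have [ab|ba] := leP a b.
  have wE (G : R -> R) : wlength G `](a, b).1, (a, b).2]%classic = (G b - G a)%:E.
    exact: wlength_itv_bnd.
  rewrite (wE F) [X in (_ * X)%E](wE idfun).
  by rewrite -EFinM lee_fin F_lip.
have wE (G : R -> R) : wlength G `](a, b).1, (a, b).2]%classic = 0%E.
  by rewrite set_itv_ge ?wlength0// bnd_simp -leNgt ltW.
by rewrite (wE F) [X in (_ * X)%E](wE idfun) mule0.
Qed.

End StieltjesLipschitz.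

(** * Differentiability almost everywhere of Lipschitz functions *)

Section LipschitzDerivable.
Context {R : realType}.
Variables (f : R -> R) (L : R).
Hypotheses (L_gt0 : 0 < L)
  (f_lip : forall x y, `|f x - f y| <= L * `|x - y|).
Local Notation lambda := (@lebesgue_measure R).

(* [F] clamps [f] to [0, 1] and adds [L x] to make it monotone; its Stieltjes
   measure is dominated by the Lebesgue measure and hence has a density. *)
Let cl (x : R) : R := Num.min (Num.max x 0) 1.
Let F (x : R) : R := f (cl x) + L * cl x.

Let cl_nd (x y : R) : x <= y -> 0 <= cl y - cl x <= y - x.
Proof.
by move=> xy; rewrite /cl /Num.min /Num.max; do 4 case: ifPn; rewrite -?leNgt; lra.
Qed.

Let F_incr (x y : R) : x <= y -> 0 <= F y - F x <= (2 * L) * (y - x).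
Proof.
move=> xy; rewrite /F; have /andP[c0 c1] := cl_nd xy.
have := f_lip (cl y) (cl x); rewrite (ger0_norm c0) ler_norml => /andP[f1 f2].
have h : L * (cl y - cl x) <= L * (y - x) by rewrite ler_wpM2l// ltW.
by apply/andP; split; lra.
Qed.

Let F_nd : nondecreasing F.
Proof. by move=> x y xy; have /andP[] := F_incr xy; rewrite subr_ge0. Qed.

Let F_cont : continuous F.
Proof.
move=> x; apply/cvgrPdist_le => e e0.
have d0 : 0 < e / (2 * L) by rewrite divr_gt0// mulr_gt0.
near=> y.
have yx : `|x - y| <= e / (2 * L).
  by near: y; apply: cvgr_dist_le => //; exact: cvg_id.
rewrite ler_pdivlMr ?mulr_gt0// mulrC in yx; apply: le_trans yx.
have [xy|/ltW yx] := leP x y.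
  have /andP[h1 h2] := F_incr xy.
  by rewrite distrC [`|x - y|]distrC !ger0_norm ?subr_ge0// F_nd.
by have /andP[h1 h2] := F_incr yx; rewrite !ger0_norm ?subr_ge0// F_nd.
Unshelve. all: by end_near. Qed.

HB.instance Definition _ :=
  isCumulative.Build R _ R F F_nd (right_continuousW F_cont).

Local Notation nu := (lebesgue_stieltjes_measure F).

(** Rademacher's theorem on the line. On []0, 1[] the primitive of the Radon-Nikodym density is
    [f y + L * y - F 0], and the primitive of an integrable function is differentiable almost
    everywhere. *)
Lemma lipschitz_ae_derivable :
  {ae lambda, forall x, x \in `]0, 1[ -> derivable f x 1}.
Proof.
have F_lip (x y : R) : x <= y -> F y - F x <= (2 * L) * (y - x).
  by move=> /F_incr/andP[].
have mE : measurable (`]0, 1]%classic : set (measurableTypeR R)) by exact: measurable_itv.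
have nuE : (nu `]0%R, 1%R] < +oo)%E by rewrite stieltjes_oc// ltry.
(* The restriction to []0, 1]] is finite, so its density is integrable and has a primitive starting
   at [-oo]. *)
pose nuR : {finite_measure set (measurableTypeR R) -> \bar R} := mfrestr mE nuE.
have dom : nuR `<< lambda.
  apply/null_content_dominatesP => A mA A0; apply/eqP.
  rewrite eq_le measure_ge0 andbT.
  have L20 : 0 < 2 * L by rewrite mulr_gt0.
  rewrite -(stieltjes_null F_lip L20 A0).
  by apply: le_measure; rewrite ?inE//; exact: measurableI.
have [g [_ gfin gint nug]] := radon_nikodym_sigma_finite dom.
pose h := fine \o g.
have gh : g = EFin \o h by apply/funext => x; rewrite /h /= fineK.
rewrite gh in gint nug.
have inth y : lambda.-integrable `]-oo, y] (EFin \o h).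
  exact: integrableS gint.
have loch : locally_integrable [set: R] h.
  exact: open_integrable_locally openT gint.
have := FTC1Ny inth loch.
apply: filterS; first exact: (ae_filter_ringOfSetsType lambda).
move=> x /= [dG _]; rewrite in_itv /= => /andP[x0 x1].
have nearE : \forall y \near x, (fun y => \int[lambda]_(t in `]-oo, y]) h t)%R y =
    f y + L * y - F 0.
  near=> y.
  have y0 : 0 < y by near: y; exact: lt_nbhsr.
  have y1 : y < 1 by near: y; exact: lt_nbhsl.
  rewrite /= /Rintegral -nug//= /nuR /mfrestr /mrestr.
  rewrite (_ : `]-oo, y] `&` `]0, 1] = `]0, y]%classic); last first.
    by apply/seteqP; split=> z /=; rewrite !in_itv/=; lra.
  rewrite stieltjes_oc ?ltW//= /F /cl.
  by rewrite (max_l (ltW y0)) (min_l (ltW y1)).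
have dG' : derivable (fun y => f y + L * y - F 0) x 1.
  by apply: near_eq_derivable nearE dG; rewrite oner_neq0.
rewrite (_ : f = (fun y => f y + L * y - F 0) - (fun y => L * y - F 0)); last first.
  apply/funext => y.
  by change (f y = (f y + L * y - F 0) - (L * y - F 0)); ring.
by apply: derivableB.
Unshelve. all: by end_near. Qed.

End LipschitzDerivable.

(* The integrand of a conservative field involves [derive1] at points where it
   takes an arbitrary value, so it need not be measurable; [integral] is then a
   lower integral, still insensitive to null sets. *)
Section NonmeasurableIntegrand.
Context d (T : measurableType d) (R : realType).
Variables (mu : {measure set T -> \bar R}) (N : set T).
Hypotheses (mN : measurable N) (N0 : mu N = 0%E).
Implicit Types (f g : T -> \bar R) (D : set T).
Local Open Scope ereal_scope.

Import HBNNSimple.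

(** A simple function below [f], cut off on [N], keeps its integral and lies below [g]; only simple
    functions have to be measurable. *)
Lemma ge0_le_integral_off_null f g : (forall x, 0 <= f x) -> (forall x, 0 <= g x) ->
  (forall x, ~ N x -> f x <= g x) -> \int[mu]_x f x <= \int[mu]_x g x.
Proof.
move=> f0 g0 fg; rewrite (ge0_integralTE _ f0) (ge0_integralTE _ g0).
apply: ge_ereal_sup => _ [h /= hf <-].
have mNC : measurable (~` N) by exact: measurableC.
pose h' := proj_nnsfun h mNC.
have -> : sintegral mu h = sintegral mu h'.
  rewrite -!integralT_nnsfun; apply: ge0_ae_eq_integral => //.
  - exact/measurable_EFinP.
  - exact/measurable_EFinP.
  - by move=> x _; rewrite lee_fin.
  - by move=> x _; rewrite lee_fin.
  - exists N; split => // x /= /not_implyP[_ hx]; apply: contrapT => Nx; apply: hx.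
    by rewrite /h' /= mindicE mem_set ?mulr1.
apply: ereal_sup_ubound; exists h' => // x.
rewrite /h' /= mindicE; case: (pselect (N x)) => Nx.
  by rewrite memNset ?mulr0//; apply.
by rewrite mem_set// mulr1; exact: le_trans (hf x) (fg x Nx).
Qed.

Lemma ge0_eq_integral_off_null f g : (forall x, 0 <= f x) -> (forall x, 0 <= g x) ->
  (forall x, ~ N x -> f x = g x) -> \int[mu]_x f x = \int[mu]_x g x.
Proof.
move=> f0 g0 fg; apply/eqP; rewrite eq_le.
by rewrite !ge0_le_integral_off_null// => x Nx; rewrite fg.
Qed.

Lemma eq_integral_off_null D1 D2 f g :
  (forall x, ~ N x -> (f \_ D1) x = (g \_ D2) x) ->
  \int[mu]_(x in D1) f x = \int[mu]_(x in D2) g x.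
Proof.
move=> fg; rewrite integral_mkcond [RHS]integral_mkcond integralE [RHS]integralE.
congr (_ - _); apply: ge0_eq_integral_off_null => // x Nx.
  by rewrite !funeposE fg.
by rewrite !funenegE fg.
Qed.

End NonmeasurableIntegrand.

(** Serves to exclude empty values of a conservative field. The negative part has infinite integral,
    and since [+oo - +oo = -oo] the positive part does not matter. *)
Lemma integral_eqNy d (T : measurableType d) (R : realType)
    (mu : {measure set T -> \bar R}) (D E : set T) (f : T -> \bar R) :
  measurable E -> (0 < mu E)%E ->
  (forall x, E x -> D x /\ f x = -oo%E) -> (\int[mu]_(x in D) f x = -oo)%E.
Proof.
move=> mE E0 fE; rewrite integralE.
suff -> : (\int[mu]_(x in D) f^\- x = +oo)%E by rewrite addeNy.
apply/eqP; rewrite -leye_eq.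
have <- : (\int[mu]_(x in E) (cst +oo x) = +oo)%E.
  by rewrite integral_cst// gt0_mulye.
rewrite integral_mkcond [leRHS]integral_mkcond.
apply: (ge0_le_integral_off_null measurable0 (measure0 mu)) => [x|x|x _].
- by apply: erestrict_ge0 => t _; exact: leey.
- by apply: erestrict_ge0 => t _; exact: funeneg_ge0.
- rewrite /patch; case: ifPn => [/set_mem Ex|_].
    by have [Dx fx] := fE x Ex; rewrite mem_set// funenegE fx/= maxye.
  by case: ifP => _; [exact: funeneg_ge0|exact: lexx].
Qed.

(** * Lipschitz curves and the support function of their derivative *)

Section LipschitzCurve.
Variables (R : realType) (n : nat) (gamma : R -> 'rV[R]_n) (L : R).
Hypotheses (L_gt0 : 0 < L)
  (gamma_lip : forall s t, `|gamma s - gamma t| <= L * `|s - t|).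
Local Notation lambda := (@lebesgue_measure R).

Lemma lipschitz_curve_continuous : continuous gamma.
Proof.
move=> s; apply/cvgrPdist_le => e e0; near=> t.
apply: (le_trans (gamma_lip s t)); rewrite -ler_pdivlMl// mulrC.
by near: t; apply: cvgr_dist_le; [exact: cvg_id | rewrite divr_gt0].
Unshelve. all: by end_near. Qed.

Lemma lipschitz_curve_ac : absolutely_continuous01 gamma.
Proof.
move=> e e0; have K0 : 0 < n%:R * L + 1 by rewrite ltr_wpDl// mulr_ge0// ltW.
exists (e / (n%:R * L + 1)); first by rewrite divr_gt0.
move=> p a b ab _; rewrite ltr_pdivlMr// mulrC => lte.
apply: le_lt_trans lte; rewrite mulr_sumr; apply: ler_sum => i _.
have [_ abi _] := ab i.
apply: (le_trans (norm2_le_norm _)).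
apply: (@le_trans _ _ (n%:R * (L * (b i - a i)))).
  by rewrite ler_wpM2l// (le_trans (gamma_lip _ _))// ger0_norm ?subr_ge0.
by rewrite mulrA ler_wpM2r ?subr_ge0// lerDl.
Qed.

Lemma lipschitz_curve_ae_derivable :
  {ae lambda, forall s, s \in `]0, 1[ -> derivable gamma s 1}.
Proof.
have coord i :
    {ae lambda, forall s, s \in `]0, 1[ -> derivable (fun t => gamma t 0 i) s 1}.
  apply: (lipschitz_ae_derivable L_gt0) => s t.
  apply: le_trans (gamma_lip s t).
  by have := norm_coord (gamma s - gamma t) i; rewrite !mxE.
have /filter_forall : forall i, \forall s \near almost_everywhere lambda,
  s \in `]0, 1[ -> derivable (fun t => gamma t 0 i) s 1 by [].
apply: filterS => s ds s01.
have /choice[l lP] : forall i, exists l : R,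
    (fun h => h^-1 *: (((fun t => gamma t 0 i) \o shift s) (h *: (1 : R))
      - gamma s 0 i)) @ 0^' --> l.
  by move=> i; have /cvg_ex := ds i s01.
apply/cvg_ex; exists (\row_i l i); apply/cvg_rowP => i; rewrite mxE.
apply: cvg_trans (lP i); apply: near_eq_cvg; apply: nearW => h /=.
by rewrite !mxE.
Qed.

Lemma cvg_derive1 s : derivable gamma s 1 ->
  h^-1 *: (gamma (h + s) - gamma s) @[h --> 0^'] --> derive1 gamma s.
Proof.
move=> ds; rewrite /derive1; apply/cvgP; move: ds => /cvg_ex[l ds].
apply/cvg_ex; exists l; apply: cvg_trans ds.
apply: near_eq_cvg; apply: nearW => h /=.
by rewrite [h%:A]mulr1.
Qed.

Lemma cvg_derive1_seq s : derivable gamma s 1 ->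
  k.+1%:R *: (gamma (s + k.+1%:R^-1) - gamma s) @[k --> \oo] --> derive1 gamma s.
Proof.
move=> /cvg_derive1 ds.
have h0 : @harmonic R @ \oo --> 0^'.
  move=> A A0; have : \forall k \near \oo, harmonic k != 0 :> R -> A (harmonic k).
    exact: (@cvg_harmonic R _ A0).
  by apply: filterS => k; apply; exact: lt0r_neq0 (harmonic_gt0 k).
apply: cvg_trans (cvg_comp _ _ h0 ds); apply: near_eq_cvg; apply: nearW => k /=.
by rewrite invrK [s + _]addrC.
Qed.

Lemma norm_derive1_le s : derivable gamma s 1 -> `|derive1 gamma s| <= L.
Proof.
move=> /cvg_derive1_seq ds; apply: cvgr_to_le (cvg_norm ds) _.
apply: nearW => k; rewrite normrZ ger0_norm// -ler_pdivlMl ?ltr0n//.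
rewrite (le_trans (gamma_lip _ _))// addrAC subrr add0r.
by rewrite ger0_norm ?invr_ge0// mulrC.
Qed.

Section SupportAlongCurve.
Variables (D : 'rV[R]_n -> set 'rV[R]_n) (B : R).
Hypotheses (cD : graph_closed D) (lbD : locally_bounded D)
  (Dne : forall x, D x !=set0) (gammaB : forall s, `|gamma s| <= B).

Let phi s : R := sup_dot (D (gamma s)) (derive1 gamma s).

Lemma sup_dot_lip x (C : R) u v : (forall l, D x l -> `|l| <= C) ->
  `|sup_dot (D x) u - sup_dot (D x) v| <= n%:R * C * `|u - v|.
Proof.
move=> DC; have le a b : sup_dot (D x) a <= sup_dot (D x) b + n%:R * C * `|a - b|.
  apply: sup_dot_le => // l Dl; rewrite -(subrK b a) dotvDr addrC subrK lerD//.
    exact: le_sup_dot DC Dl.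
  rewrite (le_trans (ler_norm _))// (le_trans (dotv_le _ _))//.
  by rewrite ler_wpM2r// ler_wpM2l// DC.
by rewrite ler_distl lerBlDr le andbC /= distrC le.
Qed.

Lemma measurable_sup_dot_curve (w : R -> 'rV[R]_n) : continuous w ->
  measurable_fun setT (fun s => sup_dot (D (gamma s)) (w s)).
Proof.
move=> cw.
(* The support function is upper semicontinuous along the curve; its opposite is lower
   semicontinuous, hence measurable. *)
suff : measurable_fun setT (fun s => - sup_dot (D (gamma s)) (w s)).
  move=> h; have -> : (fun s => sup_dot (D (gamma s)) (w s)) =
      -%R \o (fun s => - sup_dot (D (gamma s)) (w s)).
    by apply/funext => s /=; rewrite opprK.
  exact: measurableT_comp.
apply/measurable_EFinP; apply: lower_semicontinuous_measurable => s a.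
rewrite lte_fin => lta.
have e0 : 0 < (- sup_dot (D (gamma s)) (w s) - a) / 2 by rewrite divr_gt0// subr_gt0.
have [d d0 dP] := sup_dot_usc (gamma s) (w s) cD lbD e0.
exists [set t | `|gamma t - gamma s| < d /\ `|w t - w s| < d].
  apply: filterI.
    by have /cvgrPdistC_lt := @lipschitz_curve_continuous s; exact.
  by have /cvgrPdistC_lt := cw s; exact.
move=> t [gts wts]; rewrite lte_fin.
have : sup_dot (D (gamma t)) (w t) <=
    sup_dot (D (gamma s)) (w s) + (- sup_dot (D (gamma s)) (w s) - a) / 2.
  by apply: sup_dot_le => // l; exact: dP.
by lra.
Qed.

(* Along the curve, the support function of the derivative is a limit of support
   functions of difference quotients, which are upper semicontinuous in s. *)
Lemma measurable_sup_dot_derive1 (E : set R) : measurable E ->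
  (forall s, E s -> derivable gamma s 1) -> measurable_fun E phi.
Proof.
move=> mE dE.
pose v k s : 'rV[R]_n := k.+1%:R *: (gamma (s + k.+1%:R^-1) - gamma s).
have [C C0 DC] := locally_bounded_ball B lbD.
apply: (@measurable_fun_cvg _ _ _ E (fun k s => sup_dot (D (gamma s)) (v k s))).
  move=> k; apply: measurable_funTS; apply: measurable_sup_dot_curve => s.
  apply: cvgZr; apply: cvgB; last exact: lipschitz_curve_continuous.
  apply: (@cvg_comp _ _ _ (fun t => t + k.+1%:R^-1) gamma _ (nbhs (s + k.+1%:R^-1))).
    by apply: cvgD; [exact: cvg_id | exact: cvg_cst].
  exact: lipschitz_curve_continuous.
move=> s /dE/cvg_derive1_seq ds; rewrite -/(v^~ s) in ds.
apply/cvgrPdist_le => e e0.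
have K0 : 0 < n%:R * C + 1 by rewrite ltr_wpDl// mulr_ge0.
have /cvgrPdist_le/(_ (e / (n%:R * C + 1))) := ds.
move=> /(_ (divr_gt0 e0 K0)); apply: filterS => k vk.
rewrite /phi (le_trans (sup_dot_lip _ _ (DC _ ^~ (gammaB s))))//.
rewrite ler_pdivlMr// mulrC in vk; apply: le_trans vk.
by rewrite ler_wpM2r// lerDl.
Qed.

Lemma sup_dot_derive1_bounded (E : set R) :
  (forall s, E s -> derivable gamma s 1) -> [bounded phi s | s in E].
Proof.
move=> dE; have [C C0 DC] := locally_bounded_ball B lbD.
exists (n%:R * C * L); split; first exact: num_real.
move=> K CK s Es /=; apply: (le_trans _ (ltW CK)).
have [l Dl] := Dne (gamma s).
have DC' k : D (gamma s) k -> `|k| <= C by exact: DC.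
have := sup_dot_lip (derive1 gamma s) 0 DC'.
have -> : sup_dot (D (gamma s)) 0 = 0.
  apply/eqP; rewrite eq_le sup_dot_le//= => [|k _]; last by rewrite dotv0.
  by have := le_sup_dot 0 DC' Dl; rewrite dotv0.
rewrite !subr0 => /le_trans; apply.
by rewrite ler_wpM2l ?mulr_ge0//; exact: norm_derive1_le (dE s Es).
Qed.

End SupportAlongCurve.

End LipschitzCurve.

(** * Conservative fields along Lipschitz curves *)

Section ConservativeField.
Variables (R : realType) (n : nat).
Implicit Types (h : 'rV[R]_n -> R) (D : 'rV[R]_n -> set 'rV[R]_n).
Local Notation lambda := (@lebesgue_measure R).

Lemma minr_lip (a s t : R) : `|Num.min s a - Num.min t a| <= `|s - t|.
Proof.
have := ler_norm (s - t); have := ler_norm (t - s).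
rewrite distrC ler_norml /Num.min => h1 h2.
by do 2 case: ifPn; rewrite -?leNgt => *; apply/andP; split; lra.
Qed.

Lemma ereal_sup_dot (A : set 'rV[R]_n) u (C : R) : A !=set0 ->
  (forall l, A l -> `|l| <= C) ->
  ereal_sup [set (dotv l u)%:E | l in A] = (sup_dot A u)%:E.
Proof.
move=> [l Al] bA; rewrite -ereal_sup_EFin; first by rewrite image_comp.
  exact: has_ubound_dot bA.
by exists (dotv l u), l.
Qed.

Lemma sup_dot0 (A : set 'rV[R]_n) (C : R) : A !=set0 ->
  (forall l, A l -> `|l| <= C) -> sup_dot A 0 = 0.
Proof.
move=> A0 bA; apply/eqP; rewrite eq_le sup_dot_le//= => [|k _]; last by rewrite dotv0.
by have [l Al] := A0; have := le_sup_dot 0 bA Al; rewrite dotv0.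
Qed.

(** The curve reaches [x] at time 1/2 and rests there. Were [D x] empty, the integrand would be
    [-oo] on []1/2, 1[] and [h x] could not be finite. *)
Lemma conservative_field_nonempty D h x : conservative_field D h -> D x !=set0.
Proof.
move=> [_ _ _ cons]; apply: contrapT => /set0P/negP; rewrite negbK => /eqP Dx0.
pose gamma (s : R) : 'rV[R]_n := Num.min (2 * s) 1 *: x.
have K0 : 0 < 2 * `|x| + 1 by rewrite ltr_wpDl// mulr_ge0.
have lip s t : `|gamma s - gamma t| <= (2 * `|x| + 1) * `|s - t|.
  rewrite -scalerBl normrZ (le_trans (ler_wpM2r _ (minr_lip _ _ _)))//.
  rewrite -mulrBr normrM ger0_norm// mulrAC ler_wpM2r//.
  by rewrite lerDl.
have g0 : gamma 0 = 0 by rewrite /gamma mulr0 min_l ?scale0r.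
have g1 : gamma 1 = x by rewrite /gamma mulr1 min_r ?scale1r// ler1n.
have := cons x gamma (lipschitz_curve_ac K0 lip) g0 g1.
rewrite (@integral_eqNy _ _ _ lambda _ (`]2^-1, 1[%classic : set R))//.
- rewrite [ltRHS](lebesgue_measure_itv `]2^-1, 1[)/= lte_fin.
  by rewrite invf_lt1 ?ltr1n// -EFinB lte_fin subr_gt0 invf_lt1 ?ltr1n.
- move=> s /=; rewrite !in_itv/= => /andP[s0 s1]; split.
    by rewrite (ltW s1) andbT; lra.
  have -> : gamma s = x by rewrite /gamma min_r ?scale1r//; lra.
  by rewrite Dx0 image_set0 ereal_sup0.
Qed.

Section ChainRule.
Variables (D : 'rV[R]_n -> set 'rV[R]_n) (h : 'rV[R]_n -> R).
Hypothesis hD : conservative_field D h.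
Variables (gamma : R -> 'rV[R]_n) (L B : R) (N : set R).
Hypotheses (L_gt0 : 0 < L)
  (gamma_lip : forall s t, `|gamma s - gamma t| <= L * `|s - t|)
  (gammaB : forall s, `|gamma s| <= B) (gamma0 : gamma 0 = 0)
  (mN : measurable N) (N0 : lambda N = 0%E)
  (gamma_derivable : forall s, s \in `]0, 1[ -> ~ N s -> derivable gamma s 1).

Let phi s : R := sup_dot (D (gamma s)) (derive1 gamma s).
Let E1 : set R := `]0, 2^-1[%classic `\` N.
Let E2 : set R := `]2^-1, 1[%classic `\` N.

Let mE1 : measurable E1.
Proof. by apply: measurableD => //; exact: measurable_itv. Qed.

Let mE2 : measurable E2.
Proof. by apply: measurableD => //; exact: measurable_itv. Qed.

Let dE1 s : E1 s -> derivable gamma s 1.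
Proof.
move=> [/= + Ns]; rewrite in_itv/= => /andP[s0 s1]; apply: gamma_derivable => //.
by rewrite in_itv/= s0/=; lra.
Qed.

Let dE2 s : E2 s -> derivable gamma s 1.
Proof.
move=> [/= + Ns]; rewrite in_itv/= => /andP[s0 s1]; apply: gamma_derivable => //.
by rewrite in_itv/= s1 andbT; lra.
Qed.

Lemma integrable_sup_dot_derive1 (E : set R) : measurable E -> E `<=` `[0, 1] ->
  (forall s, E s -> derivable gamma s 1) -> lambda.-integrable E (EFin \o phi).
Proof.
have [_ cD lbD _] := hD; have Dne x := conservative_field_nonempty x hD.
move=> mE E01 dE; apply: measurable_bounded_integrable => //.
- apply: (@le_lt_trans _ _ (lambda `[0, 1])).
    by apply: le_measure; rewrite ?inE//; exact: measurable_itv.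
  by rewrite lebesgue_measure_itv/= lte_fin ltr01 -EFinB ltry.
- exact: (measurable_sup_dot_derive1 L_gt0 gamma_lip cD lbD Dne gammaB).
- exact: (sup_dot_derive1_bounded gamma_lip lbD Dne gammaB).
Qed.

Let N' : set R := N `|` ([set 0] `|` ([set 2^-1] `|` [set 1])).

Let mN' : measurable N'.
Proof. by do ![apply: measurableU => //]. Qed.

Let N'0 : lambda N' = 0%E.
Proof.
have z := @lebesgue_measure_set1 R.
apply: null_set_setU => //; first by do ![apply: measurableU => //].
apply: null_set_setU; [exact: measurable_set1| |exact: z|].
  by apply: measurableU; exact: measurable_set1.
by apply: null_set_setU; do ?[exact: measurable_set1|exact: z].
Qed.

Let curve_integrand s : ereal_sup [set (dotv l (derive1 gamma s))%:E | l in D (gamma s)]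
  = (phi s)%:E.
Proof.
have [_ _ lbD _] := hD; have [C _ DC] := locally_bounded_ball B lbD.
apply: (@ereal_sup_dot _ _ C); first exact: (conservative_field_nonempty _ hD).
by move=> l; exact: DC.
Qed.

Let gamma_half s := gamma (Num.min s 2^-1).

Let gamma_half_lip s t : `|gamma_half s - gamma_half t| <= L * `|s - t|.
Proof.
apply: (le_trans (gamma_lip _ _)).
by rewrite ler_pM2l// minr_lip.
Qed.

(** The defining identity concerns only curves that start at 0 and run over all of [[0, 1]].
    Subtracting the identity for the curve stopped at time 1/2 leaves the integral over the second
    half. *)
Lemma conservative_chain_rule :
  ((h (gamma 1) - h (gamma 2^-1))%:E = \int[lambda]_(s in E2) (phi s)%:E)%E.
Proof.
have [_ _ lbD cons] := hD; have [C _ DC] := locally_bounded_ball B lbD.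
have id1 := cons _ gamma (lipschitz_curve_ac L_gt0 gamma_lip) gamma0 erefl.
have h0 : gamma_half 0 = 0 by rewrite /gamma_half min_l//; lra.
have h1 : gamma_half 1 = gamma 2^-1 by rewrite /gamma_half min_r//; lra.
have id2 := cons _ gamma_half (lipschitz_curve_ac L_gt0 gamma_half_lip) h0 h1.
have off s : ~ N' s -> [/\ ~ N s, s <> 0, s <> 2^-1 & s <> 1].
  by move=> N's; split=> [?|s0|s0|s0]; apply: N's; [left|right; left|
    right; right; left|right; right; right].
rewrite (@eq_integral_off_null _ _ R lambda N' mN' N'0 _ (E1 `|` E2) _ (EFin \o phi))
  in id1; last first.
  move=> s /off[Ns s0 s12 s1]; rewrite /patch curve_integrand.
  suff -> : (s \in `[0, 1]%classic) = (s \in E1 `|` E2) by [].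
  apply/idP/idP; rewrite !inE /= !in_itv/=.
    move=> /andP[]; rewrite le_eqVlt => /predU1P[/esym//|s_gt0].
    rewrite le_eqVlt => /predU1P[//|s_lt1].
    have [s_lt|s_gt|//] := ltgtP s 2^-1; [left|right]; split => //=.
      by rewrite in_itv/= s_gt0.
    by rewrite in_itv/= s_gt.
  by move=> [] [/=]; rewrite in_itv/= => /andP[? ?] _; apply/andP; split; lra.
rewrite (@eq_integral_off_null _ _ R lambda N' mN' N'0 _ E1 _ (EFin \o phi))
  in id2; last first.
  move=> s /off[Ns s0 s12 s1]; rewrite /patch.
  have [/set_mem sE1|sE1] := boolP (s \in E1).
    have /= /[!in_itv]/= /andP[s_gt0 s_lt] := sE1.1.
    rewrite mem_set/= ?in_itv/=; last by apply/andP; split; lra.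
    have -> : gamma_half s = gamma s by rewrite /gamma_half min_l// ltW.
    rewrite (_ : derive1 gamma_half s = derive1 gamma s) ?curve_integrand//.
    rewrite !derive1E; apply: near_eq_derive; near=> t.
    by rewrite /gamma_half min_l// ltW//; near: t; exact: lt_nbhsl.
  case: ifPn => // /set_mem/=; rewrite in_itv/= => /andP[s_ge0 s_le1].
  have s_gt : 2^-1 < s.
    rewrite ltNge le_eqVlt; apply/negP => /predU1P[//|s_lt].
    move/negP: sE1; apply; rewrite inE; split => //=.
    by rewrite in_itv/= s_lt andbT lt_neqAle s_ge0 andbT eq_sym; apply/eqP.
  (* Past time 1/2 the stopped curve is locally constant, and the support function of a nonempty
     bounded set vanishes in the direction 0. *)
  have -> : derive1 gamma_half s = 0.
    rewrite -(derive1_cst (gamma 2^-1) s) !derive1E.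
    apply: near_eq_derive; near=> t.
    by rewrite /gamma_half min_r// ltW//; near: t; exact: lt_nbhsr.
  have DC' l : D (gamma_half s) l -> `|l| <= C by apply: DC; exact: gammaB.
  have Dne := conservative_field_nonempty (gamma_half s) hD.
  by rewrite (ereal_sup_dot _ Dne DC') (sup_dot0 Dne DC').
have i1 : lambda.-integrable E1 (EFin \o phi).
  apply: integrable_sup_dot_derive1 => // s [/= + _]; rewrite !in_itv/=; lra.
have i2 : lambda.-integrable E2 (EFin \o phi).
  apply: integrable_sup_dot_derive1 => // s [/= + _]; rewrite !in_itv/=; lra.
move: id1; rewrite integral_setU//=; last 2 first.
- apply/measurable_funU => //.
  by split; [exact: measurable_int i1|exact: measurable_int i2].
- rewrite disj_set2E; apply/eqP; rewrite -subset0 => s [[/= + _] [/= + _]].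
  by rewrite !in_itv/=; lra.
have F1 : (\int[lambda]_(s in E1) (phi s)%:E)%E \is a fin_num.
  exact: integrable_fin_num.
have F2 : (\int[lambda]_(s in E2) (phi s)%:E)%E \is a fin_num.
  exact: integrable_fin_num.
move=> id1; rewrite EFinB id1 id2 -(fineK F1) -(fineK F2) -!EFinD.
by congr (_%:E); ring.
Unshelve. all: by end_near. Qed.

End ChainRule.

End ConservativeField.

(** * Dissipation along a time-reversed flow *)

Section ReversedFlow.
Variables (R : realType) (n N : nat) (f : 'I_N -> 'rV[R]_n -> R)
  (D : 'I_N -> 'rV[R]_n -> set 'rV[R]_n).
Hypothesis fD : forall i, conservative_field (D i) (f i).
Local Notation lambda := (@lebesgue_measure R).

(** The velocity bound is used twice: with [u] the derivative itself it makes [Psi] nonnegative and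
    controls the squared speed; where the speed vanishes it yields the conclusion for every [u]. The
    bad times form a null set, so a good one exists after any [a < 1]. *)
Lemma reversed_flow_critical (gamma : R -> 'rV[R]_n) (L B c a : R) :
  0 < L -> (forall s t, `|gamma s - gamma t| <= L * `|s - t|) ->
  (forall s, `|gamma s| <= B) -> gamma 0 = 0 -> 0 < c ->
  (forall s u, 2^-1 < s < 1 -> derivable gamma s 1 ->
    dotv (derive1 gamma s) u <= c * \sum_i sup_dot (D i (gamma s)) u) ->
  \sum_i f i (gamma 1) <= \sum_i f i (gamma 2^-1) ->
  2^-1 <= a < 1 ->
  exists2 s, a < s < 1 & forall u, 0 <= \sum_i sup_dot (D i (gamma s)) u.
Proof.
move=> L0 lip gB g0 c0 vel le_f /andP[a_ge a_lt].
have [N0 [mN N00 dN]] := lipschitz_curve_ae_derivable L0 lip.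
have der s : s \in `]0, 1[ -> ~ N0 s -> derivable gamma s 1.
  by move=> s01 Ns; apply: contrapT => nd; apply: Ns; apply: dN => /(_ s01).
pose E2 : set R := `]2^-1, 1[%classic `\` N0.
have mE2 : measurable E2 by apply: measurableD => //; exact: measurable_itv.
pose phi i s := sup_dot (D i (gamma s)) (derive1 gamma s).
pose Psi s := \sum_i phi i s.
have dE2 s : E2 s -> 2^-1 < s < 1 /\ derivable gamma s 1.
  move=> [/= + Ns]; rewrite in_itv/= => s01; split => //.
  by apply: der => //; rewrite in_itv/=; lra.
have intphi i : lambda.-integrable E2 (EFin \o phi i).
  apply: (integrable_sup_dot_derive1 (fD i) L0 lip gB) => //.
    by move=> s [/= + _]; rewrite !in_itv/=; lra.
  by move=> s /dE2[].
have intPsi : (\int[lambda]_(s in E2) (Psi s)%:E <= 0)%E.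
  under eq_integral do rewrite -sumEFin.
  rewrite integral_sum//.
  under eq_bigr do rewrite -(conservative_chain_rule (fD _) L0 lip gB g0 mN N00 der).
  by rewrite sumEFin lee_fin sumrB subr_le0.
have Psi_ge s : E2 s -> dotv (derive1 gamma s) (derive1 gamma s) <= c * Psi s.
  by move=> /dE2[s01 ds]; exact: vel.
have Psi_ge0 s : E2 s -> 0 <= Psi s.
  move=> /Psi_ge h; rewrite -(pmulr_rge0 _ c0); apply: le_trans h; exact: dotvv_ge0.
have mPsi : measurable_fun E2 (EFin \o Psi).
  apply/measurable_EFinP; apply: measurable_sum => i.
  by have /integrableP[/measurable_EFinP] := intphi i.
have int0 : (\int[lambda]_(s in E2) `|(EFin \o Psi) s| = 0)%E.
  apply/eqP; rewrite eq_le integral_ge0// andbT; apply: le_trans intPsi.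
  rewrite le_eqVlt; apply/orP; left; apply/eqP; apply: eq_integral => s /set_mem sE.
  by rewrite /= ger0_norm// Psi_ge0.
have [N2 [mN2 N20 PsiN]] : ae_eq lambda E2 (EFin \o Psi) (cst 0%E).
  by apply/ae_eq_integral_abs.
have [s [sa s1 Ns N2s]] : exists s, [/\ a < s, s < 1, ~ N0 s & ~ N2 s].
  apply: contrapT => ns.
  have sub : `]a, 1[%classic `<=` N0 `|` N2.
    move=> s /=; rewrite in_itv/= => /andP[? ?]; apply: contrapT => /not_orP[? ?].
    by apply: ns; exists s.
  have : (lambda (`]a, 1[%classic : set R)%R <= lambda (N0 `|` N2))%E.
    by apply: le_measure => //; rewrite inE; [exact: measurable_itv|exact: measurableU].
  rewrite [leRHS]null_set_setU// [leLHS](lebesgue_measure_itv `]a, 1[)/= lte_fin a_lt.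
  by rewrite -EFinB lee_fin subr_le0 leNgt a_lt.
exists s; first by rewrite sa.
have sE2 : E2 s by split => //=; rewrite in_itv/= s1 andbT; exact: le_lt_trans sa.
have Psi0 : Psi s = 0.
  by apply: contrapT => nz; apply: N2s; apply: PsiN => /= /(_ sE2)[].
have g'0 : derive1 gamma s = 0.
  apply: dotvv_eq0; apply/eqP; rewrite eq_le dotvv_ge0 andbT.
  by have := Psi_ge s sE2; rewrite Psi0 mulr0.
move=> u; have [s01 ds] := dE2 s sE2; have := vel s u s01 ds.
by rewrite g'0 dot0v pmulr_rge0.
Qed.

End ReversedFlow.

(** * Zero in a convex hull *)

Section ConvexHull.
Variables (R : realType) (n : nat).
Implicit Types (A B : set 'rV[R]_n).

(** The fixed number of points is what lets combinations pass to the limit. The weights form a row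
    vector, so that they converge as a single bounded sequence. *)
Definition convex_combs m A : set 'rV[R]_n :=
  [set p | exists w : 'rV[R]_m, exists a : 'I_m -> 'rV[R]_n,
    [/\ forall i, 0 <= w 0 i, \sum_i w 0 i = 1, forall i, A (a i) &
        p = \sum_i w 0 i *: a i]].

Lemma convex_comb_in m B (w : 'I_m -> R) (a : 'I_m -> 'rV[R]_n) :
  @convex_set R 'rV[R]_n B -> (forall i, 0 <= w i) -> \sum_i w i = 1 ->
  (forall i, B (a i)) -> B (\sum_i w i *: a i).
Proof.
move=> cB; elim: m w a => [|m IH] w a w0 w1 Ba.
  by move: w1; rewrite big_ord0 => /esym/eqP; rewrite oner_eq0.
have r0 : 0 <= \sum_(i < m) w (lift ord0 i) by exact: sumr_ge0.
rewrite big_ord_recl in w1; rewrite big_ord_recl.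
have [r_eq|r_neq] := eqVneq (\sum_(i < m) w (lift ord0 i)) 0.
  rewrite big1 ?addr0; last first.
    by move=> i _; rewrite (psumr_eq0P _ r_eq) ?scale0r.
  by move: w1; rewrite r_eq addr0 => ->; rewrite scale1r.
have r_gt0 : 0 < \sum_(i < m) w (lift ord0 i) by rewrite lt_def r_neq.
set r := \sum_(i < m) w (lift ord0 i) in r0 w1 r_neq r_gt0 *.
have Br : B (\sum_(i < m) (r^-1 * w (lift ord0 i)) *: a (lift ord0 i)).
  apply: IH => [i||i]; [by rewrite mulr_ge0// invr_ge0 | | exact: Ba].
  by rewrite -mulr_sumr mulVf.
have w01 : w ord0 <= 1 by rewrite -w1 lerDl.
have := cB (a ord0) _ (Itv01 (w0 ord0) w01) (mem_set (Ba ord0)) (mem_set Br).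
move=> /set_mem; congr B; congr (_ + _).
rewrite [LHS](_ : _ = r *: \sum_(i < m) (r^-1 * w (lift ord0 i)) *: a (lift ord0 i)).
  rewrite scaler_sumr; apply: eq_bigr => i _.
  by rewrite scalerA mulrA mulfV// mul1r.
by have -> : r = 1 - w ord0 by rewrite -w1 addrC addKr.
Qed.

Lemma convex_combs_hull m A : convex_combs m A `<=` convex_hull A.
Proof.
move=> _ [w [a [w0 w1 Aa ->]]] B [cB AB].
by apply: (convex_comb_in (w := fun i => w 0 i)) => // i; exact/AB.
Qed.

(* Caratheodory: a positive affine dependence among n + 2 points lets one of
   them be discarded. *)
Lemma convex_combs_reduce A : convex_combs n.+2 A `<=` convex_combs n.+1 A.
Proof.
move=> _ [w [a [w0 w1 Aa ->]]].
(* A left kernel vector of the matrix with rows [(a i, 1)] is an affine dependence; it exists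
   because there are [n + 2] rows and [n + 1] columns. *)
pose M : 'M[R]_(n.+2, n + 1) := \matrix_(i < n.+2) row_mx (a i) (1 : 'rV[R]_1).
have /rowV0Pn[mu /sub_kermxP muM mu0] : kermx M != 0.
  rewrite kermx_eq0 /row_free neq_ltn; apply/orP; left.
  by rewrite (leq_ltn_trans (rank_leq_col M))// addn1.
have Mrow : mu *m M = \sum_i mu 0 i *: row_mx (a i) (1 : 'rV[R]_1).
  by rewrite mulmx_sum_row; apply: eq_bigr => i _; rewrite rowK.
have mua : \sum_i mu 0 i *: a i = 0.
  have e : lsubmx (mu *m M) = 0 by rewrite muM linear0.
  rewrite -[RHS]e Mrow linear_sum /=; apply: eq_bigr => i _.
  by rewrite linearZ /= row_mxKl.
have mus : \sum_i mu 0 i = 0.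
  have e : rsubmx (mu *m M) 0 0 = 0 by rewrite muM linear0 mxE.
  rewrite -[RHS]e Mrow linear_sum /= summxE; apply: eq_bigr => i _.
  by rewrite linearZ /= row_mxKr !mxE mulr1.
have [j0 muj0] : exists j, 0 < mu 0 j.
  apply: contrapT => nex; move/eqP: mu0; apply; apply/rowP => i; rewrite mxE.
  have mule k : 0 <= - mu 0 k.
    by rewrite oppr_ge0 leNgt; apply/negP => h; apply: nex; exists k.
  have := @psumr_eq0P _ _ xpredT (fun k => - mu 0 k) (fun k _ => mule k).
  by rewrite sumrN mus oppr0 => /(_ erefl i isT)/eqP; rewrite oppr_eq0 => /eqP.
(* The smallest ratio is the largest multiple of [mu] that can be subtracted while all weights stay
   nonnegative; it annihilates the weight of [j]. *)
have [j muj jmin] :=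
  @arg_minP _ _ _ j0 (fun j => 0 < mu 0 j) (fun j => w 0 j / mu 0 j) muj0.
pose t := w 0 j / mu 0 j.
have t0 : 0 <= t by rewrite divr_ge0// ltW.
have w'0 i : 0 <= w 0 i - t * mu 0 i.
  rewrite subr_ge0; have [mui|mui] := ltP 0 (mu 0 i).
    by rewrite -ler_pdivlMr//; exact: jmin.
  by rewrite (le_trans _ (w0 i))// mulr_ge0_le0.
have w'j : w 0 j - t * mu 0 j = 0 by rewrite /t divfK ?subrr// gt_eqF.
exists (\row_i (w 0 (lift j i) - t * mu 0 (lift j i))), (a \o lift j); split.
- by move=> i; rewrite mxE.
- under eq_bigr do rewrite mxE.
  transitivity (\sum_i (w 0 i - t * mu 0 i)).
    by rewrite [RHS](bigD1_ord j)//= w'j add0r.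
  by rewrite sumrB -mulr_sumr mus mulr0 subr0.
- by move=> i; exact: Aa.
- under [RHS]eq_bigr do rewrite mxE.
  transitivity (\sum_i (w 0 i - t * mu 0 i) *: a i).
    under [RHS]eq_bigr do rewrite scalerBl -scalerA.
    by rewrite sumrB -scaler_sumr mua scaler0 subr0.
  by rewrite (bigD1_ord j)//= w'j scale0r add0r.
Qed.

Lemma convex_combs_sub m A : A `<=` convex_combs m.+1 A.
Proof.
move=> x Ax; have m0 : m.+1%:R != 0 :> R by rewrite pnatr_eq0.
have E : \sum_(i < m.+1) m.+1%:R^-1 = 1 :> R.
  by rewrite sumr_const card_ord -[LHS]mulr_natl mulfV.
exists (const_mx m.+1%:R^-1), (fun=> x); split => //.
- by move=> i; rewrite mxE invr_ge0.
- by under eq_bigr do rewrite mxE.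
- by under eq_bigr do rewrite mxE; rewrite -scaler_suml E scale1r.
Qed.

Lemma convex_combs_segment m A p x (t : R) : convex_combs m A p -> A x ->
  0 <= t <= 1 -> convex_combs m.+1 A (p + t *: (x - p)).
Proof.
move=> [w [a [w0 w1 Aa ->]]] Ax /andP[t0 t1].
exists (\row_i oapp (fun j => (1 - t) * w 0 j) t (unlift ord0 i)).
exists (fun i => oapp a x (unlift ord0 i)); split.
- move=> i; rewrite mxE; case: unliftP => [j _|_] //=.
  by rewrite mulr_ge0// subr_ge0.
- rewrite big_ord_recl mxE unlift_none /=.
  under eq_bigr do rewrite mxE liftK /=.
  by rewrite -mulr_sumr w1 mulr1 addrC subrK.
- by move=> i; case: unliftP => [j _|_] /=.
- rewrite big_ord_recl mxE unlift_none /=.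
  under [X in _ = _ + X]eq_bigr do rewrite mxE liftK /= -scalerA.
  rewrite -scaler_sumr scalerBl scale1r scalerBr.
  by rewrite addrCA.
Qed.

(** Weights and points of a minimizing sequence are bounded and converge along an ultrafilter;
    closedness of [A] keeps the limit among the combinations. *)
Lemma convex_combs_min_norm m A (C : R) : closed A -> (forall x, A x -> `|x| <= C) ->
  A !=set0 -> exists2 p, convex_combs m.+1 A p &
    forall q, convex_combs m.+1 A q -> dotv p p <= dotv q q.
Proof.
move=> cA AC [x0 Ax0]; set K := convex_combs m.+1 A.
have inf_lb : has_inf [set dotv p p | p in K].
  split; first by exists (dotv x0 x0), x0 => //; exact: convex_combs_sub.
  by exists 0 => _ [p _ <-]; exact: dotvv_ge0.
pose d := inf [set dotv p p | p in K].
have d_le q : K q -> d <= dotv q q.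
  by move=> Kq; apply: ge_inf; [exact: inf_lb.2 | exists q].
have /choice[s sP] : forall k : nat, exists s : 'rV[R]_m.+1 * ('I_m.+1 -> 'rV[R]_n),
    [/\ forall i, 0 <= s.1 0 i, \sum_i s.1 0 i = 1, forall i, A (s.2 i) &
     dotv (\sum_i s.1 0 i *: s.2 i) (\sum_i s.1 0 i *: s.2 i) < d + harmonic k].
  move=> k; have [_ [p [w [a [w0 w1 Aa ->]]] <-] pd] :=
    inf_adherent (harmonic_gt0 k : 0 < harmonic k :> R) inf_lb.
  by exists (w, a).
have [U UU ooU] := ultra_oo.
have wle : \forall k \near U, `|(s k).1| <= 1.
  apply: nearW => k; have [w0 w1 _ _] := sP k; apply: norm_le_coord => // i.
  rewrite ger0_norm// -w1 (bigD1 i)//= lerDl.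
  by apply: sumr_ge0 => j _; exact: w0.
have [w ws _] := ultra_cvg_bounded UU wle.
have /choice[a aP] : forall i, exists l : 'rV[R]_n, (s k).2 i @[k --> U] --> l.
  move=> i; have ale : \forall k \near U, `|(s k).2 i| <= C.
    by apply: nearW => k; have [_ _ Aa _] := sP k; exact: AC.
  by have [l al _] := ultra_cvg_bounded UU ale; exists l.
have wi i : (s k).1 0 i @[k --> U] --> w 0 i by move/cvg_rowP : ws; exact.
pose p := \sum_i w 0 i *: a i.
have sp : \sum_i (s k).1 0 i *: (s k).2 i @[k --> U] --> p.
  by apply: cvg_big => [|i _]; [exact: add_continuous | exact: cvgZ].
exists p.
  exists w, a; split => //.
  - move=> i; apply: cvgr_to_ge (wi i) _.
    by apply: nearW => k; have [] := sP k.
  - have : \sum_i (s k).1 0 i @[k --> U] --> \sum_i w 0 i.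
      by apply: cvg_big => // ; exact: add_continuous.
    move=> /cvg_unique; apply; first exact: Rhausdorff.
    by apply: cvg_near_cst; apply: nearW => k; have [] := sP k.
  - move=> i; apply: (closed_cvg _ cA _ _ (aP i)).
    by apply: nearW => k; have [] := sP k.
move=> q Kq; apply: le_trans (d_le q Kq).
have h0 : d + harmonic k @[k --> U] --> d.
  rewrite -[X in _ --> X]addr0; apply: cvgD; first exact: cvg_cst.
  by move=> V /cvg_harmonic; exact: ooU.
apply: ler_cvg_to (cvg_dotv sp sp) h0 _.
by apply: nearW => k; have [_ _ _ /ltW] := sP k.
Qed.

(** Separation at a combination [p] of least norm: some [x] in [A] has nonpositive product with [p],
    so a short move from a nonzero [p] towards [x] would decrease the norm. The move uses [n + 2]
    points, which Caratheodory brings back to [n + 1]. *)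
Lemma zero_in_convex_hull A (C : R) : closed A -> (forall x, A x -> `|x| <= C) ->
  (forall u, exists2 x, A x & 0 <= dotv x u) -> convex_hull A 0.
Proof.
move=> cA AC sup_ge0; have [x0 Ax0 _] := sup_ge0 0.
have A0 : A !=set0 by exists x0.
have [p Kp pmin] := @convex_combs_min_norm n A C cA AC A0.
suff p0 : p = 0 by rewrite -p0; exact: convex_combs_hull Kp.
have [x Ax] := sup_ge0 (- p); rewrite dotvNr oppr_ge0 => xp.
have line t : 0 <= t <= 1 -> 0 <= t * (2 * dotv p (x - p) + t * dotv (x - p) (x - p)).
  move=> t01; have := pmin _ (convex_combs_reduce (convex_combs_segment Kp Ax t01)).
  move: (x - p) => y; rewrite dotvDl !dotvDr !dotvZl !dotvZr (dotvC y p) -subr_ge0.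
  by congr (0 <= _); ring.
apply: dotvv_eq0; apply/eqP; rewrite eq_le dotvv_ge0 andbT leNgt; apply/negP => pp.
set b := dotv (x - p) (x - p) in line.
have b0 : 0 <= b by exact: dotvv_ge0.
have pxp : dotv p (x - p) <= - dotv p p by rewrite dotvBr (dotvC p x); lra.
have b1 : 0 < b + dotv p p by lra.
(* This choice gives [t <= 1] and [t * b <= dotv p p], so the second factor in [line] is at most
   [- dotv p p]. *)
pose t := dotv p p / (b + dotv p p).
have t0 : 0 < t by rewrite divr_gt0.
have t1 : t <= 1 by rewrite ler_pdivrMr//; lra.
have tb : t * b <= dotv p p.
  by rewrite mulrAC ler_pdivrMr// ler_pM2l//; lra.
have := line t; rewrite (ltW t0) t1 => /(_ isT); rewrite pmulr_rge0//; lra.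
Qed.

End ConvexHull.

(** * Zeros of the mean field through support functions *)

Section MeanField.
Variables (R : realType) (n : nat).
Implicit Types (A : set 'rV[R]_n) (D : 'rV[R]_n -> set 'rV[R]_n).

Lemma ultra_closed A : (forall (U : set_system nat) (a : nat -> 'rV[R]_n) l,
  UltraFilter U -> (forall k, A (a k)) -> a k @[k --> U] --> l -> A l) -> closed A.
Proof.
move=> Alim l /= clA.
have /choice[a aP] : forall k : nat, exists x, A x /\ `|l - x| < harmonic k.
  move=> k; have := clA _ (nbhsx_ballx l _ (harmonic_gt0 k)).
  by move=> [x [Ax]]; rewrite -ball_normE /= => lx; exists x.
have [U UU ooU] := ultra_oo.
apply: (Alim U a l) => [k|]; first exact: (aP k).1.
have al : a k @[k --> \oo] --> l.
  apply/cvgrPdist_le => e e0.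
  have /cvgrPdist_le/(_ e e0) := @cvg_harmonic R.
  apply: filterS => k; rewrite sub0r normrN ger0_norm ?harmonic_ge0//.
  by apply: le_trans; exact/ltW/(aP k).2.
by move=> B /al; exact: ooU.
Qed.

Lemma sup_dot_attained A (C : R) u : closed A -> (forall l, A l -> `|l| <= C) ->
  A !=set0 -> exists2 l, A l & sup_dot A u = dotv l u.
Proof.
move=> cA bA [l0 Al0].
have hs : has_sup [set dotv l u | l in A].
  by split; [exists (dotv l0 u), l0 | exact: has_ubound_dot bA].
have /choice[a aP] : forall k : nat, exists l, A l /\ sup_dot A u - harmonic k < dotv l u.
  move=> k; have [_ [l Al <-] lt] := sup_adherent (harmonic_gt0 k : 0 < harmonic k :> R) hs.
  by exists l.
have [U UU ooU] := ultra_oo.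
have aC : \forall k \near U, `|a k| <= C by apply: nearW => k; exact: bA (aP k).1.
have [l al _] := ultra_cvg_bounded UU aC.
have Al : A l.
  by apply: (closed_cvg _ cA _ _ al); apply: nearW => k; exact: (aP k).1.
exists l => //; apply/eqP; rewrite eq_le (le_sup_dot u bA Al) andbT.
have h0 : sup_dot A u - harmonic k @[k --> U] --> sup_dot A u.
  rewrite -[X in _ --> X]subr0; apply: cvgB; first exact: cvg_cst.
  by move=> V /cvg_harmonic; exact: ooU.
apply: ler_cvg_to h0 (cvg_dotv al (cvg_cst u)) _.
by apply: nearW => k; exact/ltW/(aP k).2.
Qed.

Lemma graph_closed_value D x : graph_closed D -> closed (D x).
Proof.
move=> cD; apply: ultra_closed => U a l UU Da al.
by apply: (graph_closed_cvg cD (cvg_cst x) al); exact: nearW.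
Qed.

Variables (N : nat) (D : 'I_N -> 'rV[R]_n -> set 'rV[R]_n).
Hypotheses (cD : forall i, graph_closed (D i)) (lbD : forall i, locally_bounded (D i))
  (Dne : forall i x, D i x !=set0).

Lemma locally_bounded_family (r : R) : exists2 C : R, 0 <= C &
  forall i x l, `|x| <= r -> D i x l -> `|l| <= C.
Proof.
have /choice[c cP] : forall i, exists C : R, 0 <= C /\
    forall x l, `|x| <= r -> D i x l -> `|l| <= C.
  by move=> i; have [C C0 DC] := locally_bounded_ball r (lbD i); exists C.
exists (\sum_i c i); first by apply: sumr_ge0 => i _; exact: (cP i).1.
move=> i x l xr Dl; apply: (le_trans ((cP i).2 _ _ xr Dl)).
by rewrite (bigD1 i)//= lerDl; apply: sumr_ge0 => j _; exact: (cP j).1.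
Qed.

(** The support function of a Minkowski sum is the sum of the support functions, and each is
    attained. Hence every [u] has a point of the scaled sum with nonnegative product. *)
Lemma mean_field_zero x : (forall u, 0 <= \sum_i sup_dot (D i x) u) ->
  mean_field D x 0.
Proof.
move=> sup_ge0; have [C C0 DC] := locally_bounded_family `|x|.
have {}DC i l : D i x l -> `|l| <= C by exact: DC.
have cDx i : closed (D i x) by apply: graph_closed_value.
have N0 : 0 <= N%:R^-1 :> R by rewrite invr_ge0.
apply: (@zero_in_convex_hull _ _ _ (N%:R^-1 * (N%:R * C))).
- apply: ultra_closed => U a l UU Aa al.
  have /choice[b bP] : forall k, exists b : 'I_N -> 'rV[R]_n,
      (forall i, D i x (b i)) /\ a k = N%:R^-1 *: \sum_i b i.
    by move=> k; have [_ [b Db <-] <-] := Aa k; exists b.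
  have /choice[c cP] : forall i, exists l : 'rV[R]_n, b k i @[k --> U] --> l.
    move=> i; have bC : \forall k \near U, `|b k i| <= C.
      by apply: nearW => k; exact: DC ((bP k).1 i).
    by have [l' bl' _] := ultra_cvg_bounded UU bC; exists l'.
  exists (\sum_i c i).
    exists c => //= i; apply: (closed_cvg _ (cDx i) _ _ (cP i)).
    by apply: nearW => k; exact: (bP k).1.
  have : a k @[k --> U] --> N%:R^-1 *: \sum_i c i.
    rewrite (_ : a = fun k => N%:R^-1 *: \sum_i b k i); last first.
      by apply/funext => k; exact: (bP k).2.
    apply: cvgZr; apply: cvg_big => //; exact: add_continuous.
  by move=> /cvg_unique; apply => //; exact: norm_hausdorff.
- move=> _ [_ [b Db <-] <-]; rewrite normrZ ger0_norm// ler_wpM2l//.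
  rewrite (le_trans (ler_norm_sum _ _ _))//.
  rewrite mulr_natl -[X in _ *+ X](card_ord N) -sumr_const.
  by apply: ler_sum => i _; exact: DC (Db i).
- move=> u; have /choice[b bP] : forall i, exists b, D i x b /\ sup_dot (D i x) u = dotv b u.
    move=> i; have [b Db bu] := sup_dot_attained u (cDx i) (DC i) (Dne i x).
    by exists b.
  exists (N%:R^-1 *: \sum_i b i).
    by exists (\sum_i b i) => //; exists b => // i; exact: (bP i).1.
  rewrite dotvZl mulr_ge0// dotv_suml.
  by under eq_bigr do rewrite -(bP _).2.
Qed.

End MeanField.

(** * Limit curves of the iteration *)

Section StepSizes.
Variables (R : realType) (eta V : nat -> R).
Hypotheses (eta_gt0 : forall k, 0 < eta k) (eta_cvg0 : eta @ \oo --> 0)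
  (eta_var : forall k, `|eta k.+1 - eta k| <= V k.+1 - V k) (V_cvg : cvgn V).

Definition clock k : R := \sum_(l < k) eta l.
Hypothesis clock_unbounded : forall A : R, exists k, A <= clock k.

Lemma clockS k : clock k.+1 = clock k + eta k.
Proof. by rewrite /clock big_ord_recr. Qed.

Lemma clock_le a b : (a <= b)%N -> clock a <= clock b.
Proof.
move=> /subnKC <-; elim: (b - a)%N => [|k IH]; first by rewrite addn0.
by rewrite addnS clockS (le_trans IH)// lerDl ltW.
Qed.

Lemma eta_small (e : R) : 0 < e -> \forall k \near \oo, forall l, (k <= l)%N -> eta l <= e.
Proof.
move=> e0; have /cvgrPdist_le/(_ e e0)[k0 _ k0P] := eta_cvg0.
exists k0 => // k /= k0k l kl; have := k0P l (leq_trans k0k kl).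
by rewrite /= sub0r normrN ger0_norm// ltW.
Qed.

(** [b] is the first index from [k] on at which time [t] has elapsed, so the overshoot is at most
    one step. For negative [t] it is [k] itself and the overshoot need not be small, hence the
    condition [0 <= t]. *)
Lemma clock_reach k t : exists b, [/\ (k <= b)%N, t <= clock b - clock k &
  0 <= t -> exists2 l, (k <= l)%N & clock b - clock k <= t + eta l].
Proof.
have exb : exists b, (k <= b)%N && (clock k + t <= clock b).
  have [b tb] := clock_unbounded (clock k + t); exists (maxn k b).
  by rewrite leq_maxl (le_trans tb)// clock_le// leq_maxr.
have [b /andP[kb tb] bmin] := ex_minnP exb.
exists b; split => //; first by rewrite lerBrDl.
move=> t0; move: kb; rewrite leq_eqVlt => /orP[/eqP <-|kb].
  by exists k => //; rewrite subrr addr_ge0// ltW.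
case: b kb tb bmin => // b kb tb bmin; exists b => //.
rewrite clockS; have : clock b < clock k + t.
  by rewrite ltNge; apply/negP => h; have := bmin b; rewrite h andbT => /(_ kb); rewrite ltnn.
by lra.
Qed.

(** Summation by parts moves the differences from [p] to [eta], whose variation is controlled by
    [V]. *)
Lemma abel_bound (p : nat -> R) (K : R) a b : (forall k, `|p k| <= K) -> (a <= b)%N ->
  `|\sum_(a <= l < b) eta l * (p l.+1 - p l)| <= K * (eta a + eta b + (V b - V a)).
Proof.
move=> pK ab.
(* Without its boundary terms the sum is [- \sum (eta l.+1 - eta l) * p l.+1], which the induction
   extends term by term. *)
have : `|\sum_(a <= l < b) eta l * (p l.+1 - p l) - eta b * p b + eta a * p a|
    <= K * (V b - V a).
  move: ab => /subnKC <-; elim: (b - a)%N => [|k IH].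
    by rewrite addn0 big_geq// sub0r addNr normr0 subrr mulr0.
  rewrite addnS big_nat_recr ?leq_addr//=; set c := (a + k)%N in IH *.
  set S := \sum_(_ <= _ < _) _ in IH *.
  rewrite (_ : _ + _ = (S - eta c * p c + eta a * p a) - (eta c.+1 - eta c) * p c.+1); last by ring.
  rewrite (le_trans (ler_normB _ _))// normrM.
  have : `|eta c.+1 - eta c| * `|p c.+1| <= (V c.+1 - V c) * K.
    by rewrite ler_pM.
  by lra.
set S := \sum_(_ <= _ < _) _ => h.
have ha : `|eta a * p a| <= eta a * K by rewrite normrM gtr0_norm// ler_pM2l.
have hb : `|eta b * p b| <= eta b * K by rewrite normrM gtr0_norm// ler_pM2l.
rewrite (_ : S = (S - eta b * p b + eta a * p a) + eta b * p b - eta a * p a); last by ring.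
rewrite (le_trans (ler_normB _ _))// (le_trans (lerD (ler_normD _ _) (lexx _)))//.
lra.
Qed.

Lemma abel_small (p : nat -> R) (K : R) (e : R) : (forall k, `|p k| <= K) -> 0 < e ->
  \forall a \near \oo, forall b c, (a <= b)%N -> (b <= c)%N ->
    `|\sum_(b <= l < c) eta l * (p l.+1 - p l)| <= e.
Proof.
move=> pK e0; have K0 : 0 <= K := le_trans (normr_ge0 _) (pK 0).
(* The four units are two step sizes and an increment of [V] of at most [2 * e']; [K + 1] avoids a
   division by zero. *)
pose e' := e / (4 * (K + 1)).
have e'0 : 0 < e' by rewrite divr_gt0// mulr_gt0// ltr_wpDl.
have /cvg_ex[v /cvgrPdist_le/(_ e' e'0)] := V_cvg.
move=> [k1 _ k1P]; have [k2 _ k2P] := eta_small e'0.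
exists (maxn k1 k2) => // a /=; rewrite geq_max => /andP[ka1 ka2] b c ab bc.
rewrite (le_trans (abel_bound pK bc))//.
have etab := k2P a ka2 b ab; have etac := k2P a ka2 c (leq_trans ab bc).
have := k1P b (leq_trans ka1 ab); rewrite /= ler_distl => /andP[V1 V2].
have := k1P c (leq_trans ka1 (leq_trans ab bc)).
rewrite /= ler_distl => /andP[V3 V4].
apply: (@le_trans _ _ (K * (4 * e'))); first by rewrite ler_wpM2l//; lra.
have -> : e = (K + 1) * (4 * e') by rewrite /e'; field; rewrite gt_eqF// ltr_wpDl.
by rewrite ler_wpM2r ?lerDl// mulr_ge0// ltW.
Qed.

End StepSizes.

(** * Pointwise limits of the iterates in elapsed time *)

Section LimitCurve.
Variables (R : realType) (n : nat) (eta V : nat -> R) (x m : nat -> 'rV[R]_n) (B C : R).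
Hypotheses (eta_gt0 : forall k, 0 < eta k) (eta_cvg0 : eta @ \oo --> 0)
  (eta_var : forall k, `|eta k.+1 - eta k| <= V k.+1 - V k) (V_cvg : cvgn V)
  (clock_unbounded : forall A : R, exists k, A <= clock eta k)
  (xB : forall k, `|x k| <= B) (C_gt0 : 0 < C) (mC : forall k, `|m k| <= C)
  (x_step : forall k, x k.+1 = x k - eta k *: m k.+1).

Lemma step_sum a b : (a <= b)%N -> x a - x b = \sum_(a <= l < b) eta l *: m l.+1.
Proof.
move=> /subnKC <-; elim: (b - a)%N => [|k IH].
  by rewrite addn0 big_geq// subrr.
rewrite addnS big_nat_recr ?leq_addr//= -IH x_step.
by rewrite opprB addrCA [RHS]addrC addrA.
Qed.

Lemma clock_sum a b : (a <= b)%N -> clock eta b - clock eta a = \sum_(a <= l < b) eta l.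
Proof.
move=> /subnKC <-; elim: (b - a)%N => [|k IH].
  by rewrite addn0 big_geq// subrr.
by rewrite addnS big_nat_recr ?leq_addr//= -IH clockS addrAC.
Qed.

Lemma step_dist_le a b : (a <= b)%N -> `|x a - x b| <= C * (clock eta b - clock eta a).
Proof.
move=> ab; rewrite step_sum// clock_sum// mulr_sumr (le_trans (ler_norm_sum _ _ _))//.
by apply: ler_sum => l _; rewrite normrZ gtr0_norm// mulrC ler_wpM2r ?mC ?ltW.
Qed.

Lemma step_dist a b : `|x a - x b| <= C * `|clock eta a - clock eta b|.
Proof.
have [ab|/ltnW ba] := leqP a b.
  by rewrite [X in C * X]distrC ger0_norm ?subr_ge0 ?clock_le// step_dist_le.
by rewrite distrC ger0_norm ?subr_ge0 ?clock_le// step_dist_le.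
Qed.

Variables (U : set_system nat) (b : nat -> R -> nat).
Hypotheses (UU : UltraFilter U) (ooU : \oo `<=` U)
  (bP : forall k t, [/\ (k <= b k t)%N, t <= clock eta (b k t) - clock eta k &
    0 <= t -> exists2 l, (k <= l)%N & clock eta (b k t) - clock eta k <= t + eta l]).

Lemma elapsed_clock_small e : 0 < e -> \forall k \near U, forall t, 0 <= t ->
  t <= clock eta (b k t) - clock eta k <= t + e.
Proof.
move=> e0; apply: ooU; have := eta_small eta_gt0 eta_cvg0 e0.
apply: filterS => k ke t t0; have [_ -> /(_ t0)[l kl h]] := bP k t.
by rewrite (le_trans h)// lerD2l ke.
Qed.

Lemma cvg_elapsed_clock t : 0 <= t -> clock eta (b k t) - clock eta k @[k --> U] --> t.
Proof.
move=> t0; apply/cvgrPdist_le => e e0; have := elapsed_clock_small e0.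
apply: filterS => k /(_ t t0) /andP[h1 h2].
by rewrite distrC ger0_norm ?subr_ge0//; lra.
Qed.

Lemma limit_curve_exists : exists z : R -> 'rV[R]_n,
  forall t, x (b k t) @[k --> U] --> z t.
Proof.
suff /choice[z zP] : forall t, exists l : 'rV[R]_n, x (b k t) @[k --> U] --> l by exists z.
move=> t; have xBU : \forall k \near U, `|x (b k t)| <= B by exact: nearW.
by have [l xl _] := ultra_cvg_bounded UU xBU; exists l.
Qed.

Variable z : R -> 'rV[R]_n.
Hypothesis zP : forall t, x (b k t) @[k --> U] --> z t.

Lemma limit_curve_bounded t : `|z t| <= B.
Proof.
have h : `|x (b k t)| @[k --> U] --> `|z t| by exact: cvg_norm.
by apply: cvgr_to_le h _; exact: nearW.
Qed.

Lemma limit_curve_lip s t : 0 <= s -> 0 <= t -> `|z s - z t| <= C * `|s - t|.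
Proof.
move=> s0 t0.
have lhs : `|x (b k s) - x (b k t)| @[k --> U] --> `|z s - z t|.
  by apply: cvg_norm; exact: cvgB.
have rhs : C * `|(clock eta (b k s) - clock eta k) - (clock eta (b k t) - clock eta k)|
    @[k --> U] --> C * `|s - t|.
  by apply: cvgZr; apply: cvg_norm; apply: cvgB; exact: cvg_elapsed_clock.
apply: ler_cvg_to lhs rhs _; apply: nearW => k.
by rewrite opprB addrA subrK; exact: step_dist.
Qed.

Lemma limit_curve0 (y : 'rV[R]_n) : x k @[k --> U] --> y -> z 0 = y.
Proof.
move=> xy; have h : `|x (b k 0) - x k| @[k --> U] --> 0.
  have rhs : C * (clock eta (b k 0) - clock eta k) @[k --> U] --> 0.
    rewrite -[X in _ --> X](mulr0 C).
    by apply: cvgZr; exact: cvg_elapsed_clock.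
  apply: squeeze_cvgr (cvg_cst 0) rhs; apply: nearW => k.
  have [kb _ _] := bP k 0.
  by rewrite normr_ge0 distrC step_dist_le.
have h' : `|x (b k 0) - x k| @[k --> U] --> `|z 0 - y|.
  by apply: cvg_norm; exact: cvgB.
have : `|z 0 - y| = 0 by apply: cvg_unique h' h; exact: Rhausdorff.
by move=> /normr0_eq0/eqP; rewrite subr_eq0 => /eqP.
Qed.

Variables (N : nat) (D : 'I_N -> 'rV[R]_n -> set 'rV[R]_n) (g : nat -> 'rV[R]_n)
  (idx : nat -> 'I_N) (beta : R).
Hypotheses (cD : forall i, graph_closed (D i)) (lbD : forall i, locally_bounded (D i))
  (beta_ge0 : 0 <= beta) (beta_lt1 : beta < 1)
  (m_step : forall k, m k.+1 = beta *: m k + (1 - beta) *: g k)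
  (g_in : forall k, D (idx k) (x k) (g k))
  (idx_mean : forall c : 'I_N -> R, exists p : nat -> R, exists K : R,
     (forall k, `|p k| <= K) /\ forall k, c (idx k) = N%:R^-1 * (\sum_i c i) + (p k.+1 - p k)).

(** Between the indices reached at times [t] and [t + h] the iterates stay near [z t], where upper
    semicontinuity bounds each product [dotv (g l) u] by the support function at [z t]. By
    [idx_mean] the sampled index contributes its mean plus the increment of a bounded sequence. The
    one-sided form requires no differentiability of [z]. *)
Lemma limit_curve_velocity t u (e : R) : 0 <= t -> 0 < e ->
  exists2 h0 : R, 0 < h0 & forall h, 0 < h -> h < h0 ->
    dotv (z t - z (t + h)) u <= h * (N%:R^-1 * (\sum_i sup_dot (D i (z t)) u) + e).
Proof.
move=> t0 e0; pose c i := sup_dot (D i (z t)) u.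
have /filter_forall : forall i, \forall y \near z t, forall l, D i y l -> dotv l u <= c i + e.
  move=> i; have [d d0 dP] := @sup_dot_usc _ _ (D i) (z t) u e (@cD i) (@lbD i) e0.
  apply/nbhs_ballP; exists d => // y; rewrite -ball_normE /= distrC => yd l.
  by apply: dP; rewrite // subrr normr0.
move=> /nbhs_ballP[d /= d0 dP].
(* The iterates start within [d / 3] of [z t] and, the elapsed time being at most [2 * h], travel
   less than [2 * d / 3]. *)
exists (d / (3 * C)); first by rewrite divr_gt0// mulr_gt0.
move=> h h0; rewrite ltr_pdivlMr ?mulr_gt0// => h_lt.
have [p [K [pK pE]]] := idx_mean c.
(* With this factor the recursion reads [m l.+1 = g l - kappa *: (m l.+1 - m l)]. *)
pose kappa := beta / (1 - beta).
have kappa0 : 0 <= kappa by rewrite divr_ge0// subr_ge0 ltW.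
(* The momentum and reshuffling errors are both increments of the bounded
   sequence q, so they vanish by Abel summation. *)
pose q l := p l - kappa * dotv (m l) u.
have qK l : `|q l| <= K + kappa * (n%:R * C * `|u|).
  rewrite (le_trans (ler_normB _ _))// lerD// normrM ger0_norm// ler_wpM2l//.
  by rewrite (le_trans (dotv_le _ _))// ler_wpM2r// ler_wpM2l.
have mE l : dotv (m l.+1) u = dotv (g l) u - kappa * (dotv (m l.+1) u - dotv (m l) u).
  have h1 : 1 - beta != 0 by rewrite subr_eq0 gt_eqF.
  by rewrite m_step dotvDl !dotvZl /kappa; field.
have th0 : 0 <= t + h by rewrite addr_ge0// ltW.
have lhs : dotv (x (b k t) - x (b k (t + h))) u @[k --> U] --> dotv (z t - z (t + h)) u.
  by apply: cvg_dotv (cvg_cst u); exact: cvgB.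
pose rhs k := (clock eta (b k (t + h)) - clock eta (b k t)) * (N%:R^-1 * (\sum_i c i) + e)
  + \sum_(b k t <= l < b k (t + h)) eta l * (q l.+1 - q l).
have rhs_cvg : rhs k @[k --> U] --> h * (N%:R^-1 * (\sum_i c i) + e).
  rewrite -[X in _ --> X]addr0; apply: cvgD.
    apply: cvgZr_tmp.
    have H : (clock eta (b k (t + h)) - clock eta k) - (clock eta (b k t) - clock eta k)
        @[k --> U] --> (t + h) - t by apply: cvgB; exact: cvg_elapsed_clock.
    have th : t + h - t = h by ring.
    rewrite th in H; apply: cvg_trans H; apply: near_eq_cvg.
    by apply: nearW => k; rewrite opprB addrA subrK.
  apply/cvgrPdist_le => e1 e10.
  have sm : \forall k \near U, forall b c, (k <= b)%N -> (b <= c)%N ->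
      `|\sum_(b <= l < c) eta l * (q l.+1 - q l)| <= e1.
    by apply: ooU; exact: (abel_small eta_gt0 eta_cvg0 eta_var V_cvg qK).
  (* An overshoot of at most [h / 3] ensures that time [t] is reached no later than time [t + h]. *)
  have cl1 := elapsed_clock_small (divr_gt0 h0 (ltr0n R 3)).
  near=> k; rewrite sub0r normrN.
  have [kb _ _] := bP k t.
  have smk : forall b c, (k <= b)%N -> (b <= c)%N ->
      `|\sum_(b <= l < c) eta l * (q l.+1 - q l)| <= e1 by near: k.
  apply: smk => //; rewrite leqNgt; apply/negP => /ltnW /(clock_le eta_gt0).
  have clk : forall s, 0 <= s -> s <= clock eta (b k s) - clock eta k <= s + h / 3.
    by near: k.
  have /andP[_ A1] := clk t t0; have /andP[A2 _] := clk _ th0; lra.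
apply: ler_cvg_to lhs rhs_cvg _.
have d3 : 0 < d / 3 by rewrite divr_gt0.
have xz : \forall k \near U, `|z t - x (b k t)| < d / 3.
  by have /cvgrPdist_lt/(_ _ d3) := @zP t.
have cl1 := elapsed_clock_small (divr_gt0 h0 (ltr0n R 3)).
near=> k.
have xzk : `|z t - x (b k t)| < d / 3 by near: k.
have clk : forall s, 0 <= s -> s <= clock eta (b k s) - clock eta k <= s + h / 3.
  by near: k.
have /andP[A0 A1] := clk t t0; have /andP[A2 A3] := clk _ th0.
have bb : (b k t <= b k (t + h))%N.
  by rewrite leqNgt; apply/negP => /ltnW /(clock_le eta_gt0); lra.
rewrite step_sum// dotv_suml /rhs clock_sum// mulr_suml -big_split/=.
rewrite big_nat_cond [leRHS]big_nat_cond; apply: ler_sum => l /andP[/andP[bl lb] _].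
rewrite dotvZl -mulrDr ler_pM2l// mE.
have : dotv (g l) u <= c (idx l) + e.
  apply: (dP (x l) _ (idx l)); last exact: g_in.
  rewrite -ball_normE /=.
  rewrite -(subrK (x (b k t)) (z t)) -addrA (le_lt_trans (ler_normD _ _))//.
  have := step_dist_le bl.
  have : C * (clock eta l - clock eta (b k t)) <= C * (2 * h).
    rewrite ler_wpM2l ?ltW//.
    have := clock_le eta_gt0 (ltnW lb); lra.
  lra.
by rewrite pE /q; lra.
Unshelve. all: by end_near. Qed.

End LimitCurve.

(** * Criticality of the starting point of a limit curve *)

Section Critical.
Variables (R : realType) (n N : nat) (f : 'I_N -> 'rV[R]_n -> R)
  (D : 'I_N -> 'rV[R]_n -> set 'rV[R]_n).
Hypothesis fD : forall i, conservative_field (D i) (f i).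

(** Upper semicontinuity makes this form of criticality a closed condition; it is thereby
    transferred from points [z t] with small [t] to [z 0]. *)
Lemma sup_dot_ge0_closed (y : 'rV[R]_n) :
  (forall d : R, 0 < d -> exists2 y', `|y' - y| < d &
     forall u, 0 <= \sum_i sup_dot (D i y') u) ->
  forall u, 0 <= \sum_i sup_dot (D i y) u.
Proof.
move=> near_y u; apply/ler_addgt0Pr => e e0.
have N0 : 0 < N%:R + 1 :> R by rewrite ltr_wpDl.
pose e' := e / (N%:R + 1).
have e'0 : 0 < e' by rewrite divr_gt0.
have /filter_forall : forall i, \forall y' \near y,
    forall l, D i y' l -> dotv l u <= sup_dot (D i y) u + e'.
  move=> i; have [_ cD lbD _] := fD i.
  have [d d0 dP] := sup_dot_usc y u cD lbD e'0.
  apply/nbhs_ballP; exists d => // y'; rewrite -ball_normE /= distrC => yd l.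
  by apply: dP; rewrite // subrr normr0.
move=> /nbhs_ballP[d /= d0 dP]; have [y' yd y'P] := near_y d d0.
apply: (le_trans (y'P u)).
apply: (@le_trans _ _ (\sum_i (sup_dot (D i y) u + e'))).
  apply: ler_sum => i _; apply: sup_dot_le; first exact: conservative_field_nonempty (fD i).
  by move=> l; apply: dP; rewrite -ball_normE /= distrC.
rewrite big_split/= sumr_const card_ord lerD2l -mulr_natl.
by rewrite /e' mulrA ler_pdivrMr// mulrC ler_wpM2l ?(ltW e0)// lerDl.
Qed.

Variables (z : R -> 'rV[R]_n) (B C T : R).
Hypotheses (N_gt0 : (0 < N)%N) (C_gt0 : 0 < C) (T_gt0 : 0 < T) (zB : forall t, `|z t| <= B)
  (z_lip : forall s t, 0 <= s -> 0 <= t -> `|z s - z t| <= C * `|s - t|)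
  (z_velocity : forall t u (e : R), 0 <= t -> 0 < e ->
    exists2 h0 : R, 0 < h0 & forall h, 0 < h -> h < h0 ->
      dotv (z t - z (t + h)) u <= h * (N%:R^-1 * (\sum_i sup_dot (D i (z t)) u) + e))
  (f_le : \sum_i f i (z 0) <= \sum_i f i (z T)).

Let cl (s : R) : R := Num.min (Num.max s 0) 1.

Let cl_ge0 s : 0 <= cl s.
Proof. by rewrite /cl /Num.min /Num.max; do 2 case: ifPn; rewrite -?leNgt; lra. Qed.

Let cl_lip s t : `|cl s - cl t| <= `|s - t|.
Proof.
have := ler_norm (s - t); have := ler_norm (t - s).
rewrite distrC ler_norml /cl /Num.min /Num.max => h1 h2.
by do 4 case: ifPn; rewrite -?leNgt => *; apply/andP; split; lra.
Qed.

(* Runs along the segment from 0 to [z T] on [0, 1/2] and backwards along [z]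
   from [z T] to [z 0] on [1/2, 1]. *)
Let gamma (s : R) : 'rV[R]_n := cl (2 * s) *: z T + (z (T * cl (2 - 2 * s)) - z T).

Let gammaE s : 2^-1 <= s -> s <= 1 -> gamma s = z (T * (2 - 2 * s)).
Proof.
move=> s1 s2; have -> : gamma s = cl (2 * s) *: z T + (z (T * cl (2 - 2 * s)) - z T) by [].
have -> : cl (2 * s) = 1.
  by rewrite /cl /Num.min /Num.max; do 2 case: ifPn; rewrite -?leNgt; lra.
have -> : cl (2 - 2 * s) = 2 - 2 * s.
  by rewrite /cl /Num.min /Num.max; do 2 case: ifPn; rewrite -?leNgt; lra.
by rewrite scale1r addrCA subrr addr0.
Qed.

Let gamma_lip s t : `|gamma s - gamma t| <= (2 * `|z T| + 2 * T * C) * `|s - t|.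
Proof.
have -> : gamma s - gamma t = (cl (2 * s) - cl (2 * t)) *: z T +
    (z (T * cl (2 - 2 * s)) - z (T * cl (2 - 2 * t))).
  rewrite /gamma scalerBl opprD addrACA; congr (_ + _).
  by rewrite opprB addrA subrK.
apply: (le_trans (ler_normD _ _)); rewrite [leRHS]mulrDl; apply: lerD.
  rewrite normrZ [leRHS]mulrAC ler_wpM2r// (le_trans (cl_lip _ _))//.
  by rewrite -mulrBr normrM ger0_norm.
have T0 := ltW T_gt0; have C0 := ltW C_gt0.
rewrite (le_trans (z_lip _ _))// ?mulr_ge0//.
rewrite -mulrBr normrM (ger0_norm T0).
have : `|cl (2 - 2 * s) - cl (2 - 2 * t)| <= 2 * `|s - t|.
  apply: (le_trans (cl_lip _ _)); rewrite distrC.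
  rewrite (_ : 2 - 2 * t - _ = 2 * (s - t)); last by ring.
  by rewrite normrM ger0_norm.
move=> h; rewrite (_ : 2 * T * C * _ = C * (T * (2 * `|s - t|))); last by ring.
by rewrite !ler_wpM2l.
Qed.

Let gammaB s : `|gamma s| <= 3 * B.
Proof.
have c1 : cl (2 * s) <= 1.
  by rewrite /cl /Num.min /Num.max; do 2 case: ifPn; rewrite -?leNgt; lra.
rewrite /gamma addrC -addrA (le_trans (ler_normD _ _))//.
have zz := le_trans (normr_ge0 (z T)) (zB T).
have : `|- z T + cl (2 * s) *: z T| <= 2 * B.
  rewrite (le_trans (ler_normD _ _))// normrN normrZ ger0_norm//.
  have : cl (2 * s) * `|z T| <= 1 * `|z T| by rewrite ler_wpM2r.
  by have := zB T; lra.
by have := zB (T * cl (2 - 2 * s)); lra.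
Qed.

Lemma limit_curve_critical : mean_field D (z 0) 0.
Proof.
have cD i : graph_closed (D i) by have [] := fD i.
have lbD i : locally_bounded (D i) by have [] := fD i.
have Dne i y := conservative_field_nonempty y (fD i).
apply: mean_field_zero => //; apply: sup_dot_ge0_closed => d d0.
have L0 : 0 < 2 * `|z T| + 2 * T * C.
  by rewrite ltr_wpDl ?mulr_ge0// !mulr_gt0.
have g0 : gamma 0 = 0.
  rewrite /gamma mulr0 subr0 (_ : cl 0 = 0); last by rewrite /cl maxxx min_l.
  rewrite (_ : cl 2 = 1); last by rewrite /cl max_l// min_r// ler1n.
  by rewrite scale0r mulr1 subrr addr0.
have g1 : gamma 1 = z 0 by rewrite gammaE; [congr z; ring | lra | lra].
have g12 : gamma 2^-1 = z T by rewrite gammaE; [congr z; field | lra | lra].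
(* The second half of [gamma] runs backwards through the time of [z] at rate [2 * T]; the remaining
   factor is that of the mean. *)
have c0 : 0 < 2 * T * N%:R^-1 by rewrite !mulr_gt0// invr_gt0 ltr0n.
have vel s u : 2^-1 < s < 1 -> derivable gamma s 1 ->
    dotv (derive1 gamma s) u <= 2 * T * N%:R^-1 * \sum_i sup_dot (D i (gamma s)) u.
  move=> /andP[s12 s1] ds; pose t := T * (2 - 2 * s).
  have gs : gamma s = z t by rewrite gammaE// ltW.
  have t0 : 0 <= t by rewrite mulr_ge0 ?ltW//; lra.
  rewrite -mulrA; apply/ler_addgt0Pr => e e0.
  have e'0 : 0 < e / (2 * T) by rewrite divr_gt0// mulr_gt0.
  have [h0 h00 hP] := z_velocity u t0 e'0.
  (* A backward quotient in [s] is a forward increment of [z], the only kind that [z_velocity]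
     bounds. *)
  have quot : dotv (k.+1%:R *: (gamma s - gamma (s - k.+1%:R^-1))) u @[k --> \oo]
      --> dotv (derive1 gamma s) u.
    apply: cvg_dotv (cvg_cst u).
    have hN : (fun k => - harmonic k : R) @ \oo --> 0^'.
      move=> A A0; have : \forall k \near \oo, - harmonic k != 0 :> R -> A (- harmonic k).
        have : - harmonic k @[k --> \oo] --> (0 : R).
          by rewrite -oppr0; apply: cvgN; exact: cvg_harmonic.
        by move=> /(_ _ A0).
      by apply: filterS => k; apply; rewrite oppr_eq0; exact: lt0r_neq0 (harmonic_gt0 k).
    apply: cvg_trans (cvg_comp _ _ hN (cvg_derive1 ds)).
    apply: near_eq_cvg; apply: nearW => k /=.
    by rewrite invrN invrK scaleNr -scalerN opprB [- _ + s]addrC.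
  apply: cvgr_to_le quot _.
  have a0 : 0 < h0 / (2 * T) by rewrite divr_gt0// mulr_gt0.
  have s0 : 0 < s - 2^-1 by rewrite subr_gt0.
  near=> k.
  have hk : harmonic k < h0 / (2 * T) by near: k; exact: near_infty_natSinv_lt (PosNum a0).
  have hk2 : harmonic k < s - 2^-1.
    by near: k; exact: near_infty_natSinv_lt (PosNum s0).
  have hk0 : 0 < harmonic k :> R := harmonic_gt0 k.
  rewrite -[k.+1%:R^-1]/(harmonic k) -[k.+1%:R]invrK -[k.+1%:R^-1]/(harmonic k).
  move: (harmonic k) hk hk2 hk0 => r hk hk2 hk0.
  have -> : gamma (s - r) = z (t + 2 * T * r).
    by rewrite gammaE; [congr z; rewrite /t; ring | lra | lra].
  rewrite gs dotvZl.
  have := hP (2 * T * r); rewrite !mulr_gt0// => /(_ isT).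
  rewrite mulrC -ltr_pdivlMr ?mulr_gt0// hk => /(_ isT) h.
  rewrite -ler_pdivlMl ?invr_gt0// invrK (le_trans h)//.
  rewrite le_eqVlt; apply/orP; left; apply/eqP; field.
  by rewrite pnatr_eq0 -lt0n N_gt0 gt_eqF.
have fg : \sum_i f i (gamma 1) <= \sum_i f i (gamma 2^-1) by rewrite g1 g12.
(* On its second half [gamma] is Lipschitz with constant [2 * T * C], so after time [a] it is within
   [d] of [z 0]. *)
pose a := Num.max 2^-1 (1 - d / (2 * T * C)).
have a01 : 2^-1 <= a < 1.
  rewrite /a le_max lexx/= gt_max invf_lt1// ltr1n/= ltrBlDr ltrDl divr_gt0//.
  by rewrite !mulr_gt0.
have [s /andP[sa s1] sP] := reversed_flow_critical fD L0 gamma_lip gammaB g0 c0 vel fg a01.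
exists (gamma s) => //.
move: sa; rewrite gt_max => /andP[s12 sd].
rewrite gammaE ?ltW// (le_lt_trans (z_lip _ _))// ?mulr_ge0 ?ltW//; first by lra.
rewrite subr0 ger0_norm ?mulr_ge0 ?ltW//; last by lra.
move: sd; rewrite ltrBlDr -ltrBlDl ltr_pdivlMr ?mulr_gt0//; lra.
Unshelve. all: by end_near. Qed.

End Critical.

(** The image of an ultrafilter under [sigma] concentrates on the subsequence, and [j <= sigma j]
    makes it refine [\oo]. *)
Lemma subsequence_ultra (sigma : nat -> nat) : (forall j, (j <= sigma j)%N) ->
  exists2 U : set_system nat, UltraFilter U & \oo `<=` U /\
    forall Q : set nat, (\forall j \near \oo, Q (sigma j)) -> U Q.
Proof.
move=> sge; have [U UU ooU] := ultra_oo.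
exists (sigma @ U); first exact: ultra_fmap.
split=> [A [k _ kA]|Q]; last exact: ooU.
by apply: ooU; exists k => // j /= kj; apply: kA; exact: leq_trans kj (sge j).
Qed.

(** * From limit curves to convergence *)

Section NoInstantDrop.
Variables (R : realType) (n : nat) (x : nat -> 'rV[R]_n) (F : 'rV[R]_n -> R)
  (Z : set 'rV[R]_n) (B : R).

(* For the limit curve z issued from y, this gives F y <= F (z T) for small T. *)
Definition no_instant_drop (U : set_system nat) (y : 'rV[R]_n) : Prop :=
  exists2 r : R, 0 < r & forall e : R, 0 < e -> \forall k \near U, forall b, (k <= b)%N ->
    (forall l, (k <= l <= b)%N -> `|x l - y| < r) -> F y - e <= F (x b).

Hypotheses (xB : forall k, `|x k| <= B) (cF : continuous F)
  (x_slow : x k.+1 - x k @[k --> \oo] --> (0 : 'rV[R]_n))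
  (Z_key : forall (U : set_system nat) y, UltraFilter U -> \oo `<=` U ->
     x k @[k --> U] --> y -> no_instant_drop U y -> Z y)
  (Z_values : interior [set F y | y in Z] = set0).

Lemma ultra_limit (U : set_system nat) : UltraFilter U ->
  exists y : 'rV[R]_n, x k @[k --> U] --> y.
Proof.
move=> UU; have xBU : \forall k \near U, `|x k| <= B by exact: nearW.
by have [y xy _] := ultra_cvg_bounded UU xBU; exists y.
Qed.

Lemma cvg_ultra_F (U : set_system nat) (y : 'rV[R]_n) : UltraFilter U ->
  x k @[k --> U] --> y -> F (x k) @[k --> U] --> F y.
Proof. by move=> UU xy; apply: (cvg_comp _ _ xy); exact: cF. Qed.

Lemma noncritical_value a b : a < b -> exists2 c, a < c < b & ~ [set F y | y in Z] c.
Proof.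
move=> ab; apply: contrapT => nex.
have : interior [set F y | y in Z] ((a + b) / 2).
  have : nbhs ((a + b) / 2) `]a, b[%classic.
    by apply: near_in_itvoo; rewrite in_itv/=; apply/andP; split; lra.
  apply: filterS => c /=; rewrite in_itv/= => cab; apply: contrapT => nc; apply: nex.
  by exists c.
by rewrite Z_values.
Qed.

(** After its last passage of the level [c] before reaching [b], the sequence stays above [c] until
    [F] has risen to [b], which happens only away from the limit [y] of the passages. As the steps
    vanish, [F y = c], so [y] would be a point of [Z] at a level that [F] does not take on [Z]. *)
Lemma no_upcrossing a b : a < b ->
  (forall j, exists2 k, (j <= k)%N & F (x k) <= a) ->
  (forall j, exists2 k, (j <= k)%N & b <= F (x k)) -> False.
Proof.
move=> ab low high; have [c /andP[ac cb] ncrit] := noncritical_value ab.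
pose A k := F (x k) <= c < F (x k.+1) /\
  exists2 p, (k < p)%N & b <= F (x p) /\ forall l, (k < l <= p)%N -> c < F (x l).
have Aio j : exists k, (j <= k)%N /\ A k.
  have [k0 jk0 Fk0] := low j; have [p k0p Fp] := high k0.
  (* Counting backwards from [p], the least [i] gives the last index before [p] where [F] is at most
     [c]. *)
  have ex : exists i, (i <= p)%N && (F (x (p - i)%N) <= c).
    exists (p - k0)%N; rewrite leq_subr subKn//; apply: le_trans Fk0 (ltW ac).
  have [i /andP[ip Fi] imin] := ex_minnP ex.
  have i0 : (0 < i)%N.
    rewrite lt0n; apply/eqP => i0; move: Fi; rewrite i0 subn0 leNgt.
    by rewrite (lt_le_trans cb Fp).
  have above l : (p - i < l <= p)%N -> c < F (x l).
    move=> /andP[l1 l2]; rewrite ltNge; apply/negP => Fl.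
    have := imin (p - l)%N; rewrite leq_subr subKn// => /(_ Fl); lia.
  exists (p - i)%N; split.
    have := imin (p - k0)%N; rewrite leq_subr subKn// (le_trans Fk0 (ltW ac)).
    by move=> /(_ isT); lia.
  split; first by rewrite Fi above//; lia.
  by exists p; [lia | split].
have [sigma sP] := choice Aio.
have [U UU [ooU sU]] := subsequence_ultra (fun j => (sP j).1).
have UA : \forall k \near U, A k by apply: sU; apply: nearW => j; exact: (sP j).2.
have [y xy] := ultra_limit UU.
have Fy := cvg_ultra_F UU xy.
have xy1 : x k.+1 @[k --> U] --> y.
  have : (x k.+1 - x k) + x k @[k --> U] --> 0 + y.
    by apply: cvgD => //; move=> V /x_slow; exact: ooU.
  rewrite add0r; apply: cvg_trans; apply: near_eq_cvg; apply: nearW => k.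
  by rewrite subrK.
have Fy1 : F (x k.+1) @[k --> U] --> F y by apply: (cvg_comp _ _ xy1); exact: cF.
have Fyc : F y = c.
  apply/eqP; rewrite eq_le; apply/andP; split.
    by apply: cvgr_to_le Fy _; apply: filterS UA => k [/andP[]].
  by apply: cvgr_to_ge Fy1 _; apply: filterS UA => k [/andP[_ /ltW]].
apply: ncrit; exists y => //; apply: (Z_key UU ooU xy).
have : \forall y' \near y, F y' < b.
  by have /cvgr_lt/(_ b) := cF (x := y); rewrite Fyc; apply.
move=> /nbhs_ballP[r /= r0 rP]; exists r => // e e0.
have Fe : \forall k \near U, F y - e <= F (x k).
  by have /cvgr_ge/(_ (F y - e)) := Fy; apply; rewrite gtrBl.
apply: filterS2 UA Fe => k [_ [p kp [Fp pc]]] Fke q kq near_y.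
move: kq; rewrite leq_eqVlt => /orP[/eqP <-//|kq].
(* If [q] were beyond [p], then [p] would belong to the stretch near [y], where [F] is below [b]. *)
have [qp|pq] := leqP q p.
  rewrite Fyc (le_trans _ (ltW (pc q _))) ?kq// lerBlDr lerDl ltW//.
have : F (x p) < b.
  by apply: rP; rewrite -ball_normE /= distrC; apply: near_y; rewrite (ltnW kp) ltnW.
by rewrite ltNge Fp.
Qed.

(** The limit of [F (x k)] along one ultrafilter is the only candidate and is approached infinitely
    often; values infinitely often [e] away, above or below, would create upcrossings. Once
    [F (x k)] converges, [no_instant_drop] holds at every cluster point. *)
Lemma no_instant_drop_conclusion :
  (forall y, cluster (x @ \oo) y -> Z y) /\ cvgn (fun k => F (x k)).
Proof.
have Fcvg : cvgn (fun k => F (x k)).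
  have [U UU ooU] := ultra_oo; have [y xy] := ultra_limit UU.
  have Fy := cvg_ultra_F UU xy.
  apply/cvg_ex; exists (F y); apply: contrapT => /cvgrPdist_lt nF.
  have [e e0 far] : exists2 e : R, 0 < e &
      forall j, exists2 k, (j <= k)%N & e <= `|F y - F (x k)|.
    apply: contrapT => nex; apply: nF => e e0.
    apply: contrapT => nn; apply: nex; exists e => // j.
    apply: contrapT => nj; apply: nn; exists j => // k /= jk.
    by rewrite ltNge; apply/negP => h; apply: nj; exists k.
  have close j : exists2 k, (j <= k)%N & `|F y - F (x k)| <= e / 2.
    have c1 : \forall k \near U, `|F y - F (x k)| <= e / 2.
      by have /cvgrPdist_le/(_ (e / 2)) := Fy; apply; rewrite divr_gt0.
    have c2 : \forall k \near U, (j <= k)%N by apply: ooU; exists j.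
    by have [k [? ?]] := filter_ex (filterI c1 c2); exists k.
  have [up|/existsNP[j0 nup]] := pselect (forall j, exists2 k, (j <= k)%N & F y + e <= F (x k)).
    apply: (@no_upcrossing (F y + e / 2) (F y + e)) => //; first lra.
    move=> j; have [k jk] := close j; rewrite ler_distl => /andP[h1 h2].
    by exists k => //; lra.
  apply: (@no_upcrossing (F y - e) (F y - e / 2)) => //; first lra.
    move=> j; have [k jk h] := far (maxn j j0).
    exists k; first by move: jk; rewrite geq_max => /andP[].
    rewrite leNgt; apply/negP => h1; apply: nup; exists k.
      by move: jk; rewrite geq_max => /andP[].
    by move: h; rewrite ler_normr => /orP[]; lra.
  move=> j; have [k jk] := close j; rewrite ler_distl => /andP[h1 h2].
  by exists k => //; lra.
split=> // y cy.
have /choice[sigma sP] : forall j : nat, exists k, (j <= k)%N /\ `|x k - y| < harmonic j.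
  move=> j; have xj : (x @ \oo) [set x k | k in [set k | (j <= k)%N]].
    by exists j => // k /= jk; exists k.
  have [_ [[k /= jk <-]]] := cy _ _ xj (nbhsx_ballx y _ (harmonic_gt0 j)).
  by rewrite -ball_normE /= distrC => h; exists k.
have [U UU [ooU sU]] := subsequence_ultra (fun j => (sP j).1).
have xy : x k @[k --> U] --> y.
  apply/cvgrPdist_le => e e0; apply: sU.
  have /cvgrPdist_le/(_ e e0) := @cvg_harmonic R.
  apply: filterS => j; rewrite sub0r normrN ger0_norm ?harmonic_ge0// => h.
  by rewrite distrC (le_trans _ h)// ltW//; exact: (sP j).2.
apply: (Z_key UU ooU xy); exists 1 => // e e0.
move: Fcvg => /cvg_ex[L FL].
have FLU : F (x k) @[k --> U] --> L by move=> V /FL; exact: ooU.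
have -> : F y = L by apply: cvg_unique (cvg_ultra_F UU xy) FLU; exact: Rhausdorff.
have /cvgrPdist_le/(_ e e0)[k0 _ k0P] := FL.
apply: ooU; exists k0 => // k /= k0k b kb _.
by have := k0P b (leq_trans k0k kb); rewrite /= ler_distl => /andP[_]; lra.
Qed.

End NoInstantDrop.

(** * Realizations of the method *)

Section Reshuffling.
Variables (R : realType) (N : nat) (N_gt0 : (0 < N)%N) (pi : nat -> 'S_N).

Definition reshuffled_index k : 'I_N := pi (k %/ N) (Ordinal (ltn_pmod k N_gt0)).

(** [p] accumulates the deviations from the mean. A permutation visits each index once, so [p]
    vanishes at the end of each epoch and stays bounded in between. *)
Lemma reshuffled_index_mean (c : 'I_N -> R) : exists p : nat -> R, exists K : R,
  (forall k, `|p k| <= K) /\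
  forall k, c (reshuffled_index k) = N%:R^-1 * (\sum_i c i) + (p k.+1 - p k).
Proof.
pose cbar := N%:R^-1 * (\sum_i c i).
pose p k := \sum_(l < k) (c (reshuffled_index l) - cbar).
pose K0 := \sum_i `|c i - cbar|.
have pS k : p k.+1 = p k + (c (reshuffled_index k) - cbar) by rewrite /p big_ord_recr.
have epoch q : p (q * N)%N = 0.
  elim: q => [|q IH]; first by rewrite mul0n /p big_ord0.
  rewrite mulSnr; have pD r : p (q * N + r)%N =
      p (q * N)%N + \sum_(j < r) (c (reshuffled_index (q * N + j)) - cbar).
    elim: r => [|r IHr]; first by rewrite addn0 big_ord0 addr0.
    by rewrite addnS pS IHr big_ord_recr/= [RHS]addrA.
  rewrite pD IH add0r sumrB sumr_const card_ord.
  have -> : \sum_(j < N) c (reshuffled_index (q * N + j)) = \sum_i c i.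
    rewrite [RHS](reindex_inj (@perm_inj _ (pi q))); apply: eq_bigr => j _.
    congr c; rewrite /reshuffled_index divnMDl// divn_small// addn0.
    by congr (pi q _); apply: val_inj; rewrite /= modnMDl modn_small.
  by rewrite -mulr_natl /cbar mulrA mulfV ?mul1r ?subrr// pnatr_eq0 -lt0n.
have K00 : 0 <= K0 by apply: sumr_ge0.
have cK k : `|c (reshuffled_index k) - cbar| <= K0.
  by rewrite /K0 (bigD1 (reshuffled_index k))//= lerDl; apply: sumr_ge0.
have pr q r : `|p (q * N + r)%N| <= r%:R * K0.
  elim: r => [|r IH]; first by rewrite addn0 epoch normr0 mul0r.
  rewrite addnS pS (le_trans (ler_normD _ _))// -natr1 mulrDl mul1r.
  exact: lerD.
exists p, (N%:R * K0); split=> [k|k]; last by rewrite pS; rewrite -/cbar; ring.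
rewrite {1}(divn_eq k N) (le_trans (pr _ _))// ler_wpM2r// ler_nat.
by rewrite ltnW// ltn_pmod.
Qed.

End Reshuffling.

(** * Step sizes and momenta along one realization *)

Section Pathwise.
Variables (R : realType) (n N : nat) (N_gt0 : (0 < N)%N)
  (f : 'I_N -> 'rV[R]_n -> R) (D : 'I_N -> 'rV[R]_n -> set 'rV[R]_n).
Hypothesis fD : forall i, conservative_field (D i) (f i).

Lemma locally_lipschitz_continuous (h : 'rV[R]_n -> R) : locally_lipschitz h -> continuous h.
Proof.
move=> hL y; have [W Wy [L LP]] := hL y.
have K0 : 0 < `|L| * n%:R + 1 by rewrite ltr_wpDl// mulr_ge0.
apply/(@cvgrPdist_le _ _ _ (nbhs (y : 'rV[R]_n)) (nbhs_filter y)) => e e0; have Wy0 := nbhs_singleton Wy.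
move: Wy => /nbhs_ballP[d /= d0 dW].
apply/nbhs_ballP; exists (Num.min d (e / (`|L| * n%:R + 1))).
  by rewrite /= lt_min d0 divr_gt0.
move=> y'; rewrite -ball_normE /= lt_min => /andP[yd /ltW yy'].
have Wy' : W y' by apply: dW; rewrite -ball_normE.
rewrite (le_trans (LP _ _ Wy0 Wy'))//.
rewrite ler_pdivlMr// mulrC in yy'; apply: le_trans yy'.
apply: (@le_trans _ _ (`|L| * (n%:R * `|y - y'|))).
  apply: (@le_trans _ _ (`|L| * norm2 (y - y'))).
    by rewrite ler_wpM2r ?norm2_ge0// ler_norm.
  by rewrite ler_wpM2l// norm2_le_norm.
by rewrite mulrA ler_wpM2r// lerDl.
Qed.

Lemma cvg_sumr (T : Type) (F : set_system T) (FF : Filter F) (h : 'I_N -> T -> R)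
    (l : 'I_N -> R) : (forall i, h i t @[t --> F] --> l i) ->
  \sum_i h i t @[t --> F] --> \sum_i l i.
Proof. by move=> hl; apply: cvg_big => [|i _]; [exact: add_continuous | exact: hl]. Qed.

Lemma continuous_mean_fun : continuous (mean_fun f).
Proof.
move=> y.
have sum_cvg : \sum_i f i t @[t --> y] --> \sum_i f i y.
  apply: (@cvg_sumr _ _ (nbhs_filter y)) => i.
  by have [fL _ _ _] := fD i; exact: locally_lipschitz_continuous.
exact: cvgM (cvg_cst _) sum_cvg.
Qed.

Variables (eps0 rho beta : R) (xbar m0 : 'rV[R]_n) (pi : nat -> 'S_N)
  (x m g : nat -> 'rV[R]_n) (M : R).
Hypotheses (eps0_gt0 : 0 < eps0) (rho_gt0 : 0 < rho) (beta_ge0 : 0 <= beta)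
  (beta_lt1 : beta < 1) (x_lfm : lfm D eps0 rho beta xbar m0 pi x m g)
  (mu_gt0 : forall k, 0 < lfm_mu rho xbar x k) (xM : forall k, `|x k| <= M).

Let mu := lfm_mu rho xbar x.
Let eta := lfm_eta rho eps0 xbar x m.
Let Q k := eps0 + \sum_(l < k.+1) norm2 (m l) ^+ 2.
Let r k := (Num.sqrt (Q k))^-1.
Let idx := reshuffled_index N_gt0 pi.

Let etaE k : eta k = mu k * r k. Proof. by []. Qed.

Let cD i : graph_closed (D i). Proof. by have [] := fD i. Qed.
Let lbD i : locally_bounded (D i). Proof. by have [] := fD i. Qed.

Let g_in k : D (idx k) (x k) (g k).
Proof.
have [_ gD _ _] := x_lfm.
by have := gD (k %/ N)%N (Ordinal (ltn_pmod k N_gt0)); rewrite /= -divn_eq.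
Qed.

Let m_step k : m k.+1 = beta *: m k + (1 - beta) *: g k.
Proof. by have [_ _ ->] := x_lfm. Qed.

Let x_step k : x k.+1 = x k - eta k *: m k.+1.
Proof. by have [_ _ _ ->] := x_lfm. Qed.

(** Each momentum is a convex combination of the previous one and of an element of a bounded set. *)
Let momentum_bounded : exists2 C : R, 0 < C & forall k, `|m k| <= C.
Proof.
have [Cg Cg0 gC] := locally_bounded_family lbD M.
exists (`|m 0%N| + Cg + 1); first by rewrite ltr_wpDl// addr_ge0.
elim=> [|k IH]; first by rewrite -addrA lerDl addr_ge0.
rewrite m_step (le_trans (ler_normD _ _))// !normrZ ger0_norm// ger0_norm ?subr_ge0 ?(ltW beta_lt1)//.
have gk : `|g k| <= `|m 0%N| + Cg + 1.
  apply: (le_trans (gC _ _ _ (xM k) (g_in k))).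
  by have := normr_ge0 (m 0%N); lra.
have : beta * `|m k| <= beta * (`|m 0%N| + Cg + 1) by rewrite ler_wpM2l.
have : (1 - beta) * `|g k| <= (1 - beta) * (`|m 0%N| + Cg + 1).
  by rewrite ler_wpM2l// subr_ge0 ltW.
lra.
Qed.

Let Q_ge k : eps0 <= Q k.
Proof. by rewrite /Q lerDl; apply: sumr_ge0 => l _; rewrite sqr_ge0. Qed.

Let Q_gt0 k : 0 < Q k. Proof. exact: lt_le_trans (Q_ge k). Qed.

Let QS k : Q k.+1 = Q k + norm2 (m k.+1) ^+ 2.
Proof. by rewrite /Q big_ord_recr /= addrA. Qed.

Let Q_nd : nondecreasing_seq Q.
Proof. by apply/nondecreasing_seqP => k; rewrite QS lerDl sqr_ge0. Qed.

Let r_gt0 k : 0 < r k. Proof. by rewrite invr_gt0 sqrtr_gt0. Qed.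

Let r_ni k l : (k <= l)%N -> r l <= r k.
Proof.
by move=> kl; rewrite lef_pV2 ?posrE ?sqrtr_gt0// ler_wsqrtr// Q_nd.
Qed.

Let eta_gt0 k : 0 < eta k. Proof. by rewrite etaE mulr_gt0// mu_gt0. Qed.

Let muS k : mu k <= mu k.+1.
Proof.
rewrite /mu /lfm_mu ler_pM2l//; apply/bigmax_leP; split; first exact: bigmax_ge_id.
move=> l _.
exact: (le_bigmax 0 (fun l : 'I_k.+2 => norm2 (x l - xbar)) (widen_ord (leqnSn _) l)).
Qed.

Let mu_bounded : exists2 Bm : R, 0 < Bm & forall k, mu k <= Bm.
Proof.
have M0 : 0 <= M := le_trans (normr_ge0 _) (xM 0%N).
exists (rho * (n%:R * (M + `|xbar|) + 1)).
  by rewrite mulr_gt0// ltr_wpDl// mulr_ge0// addr_ge0.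
move=> k; rewrite /mu /lfm_mu ler_pM2l//; apply/bigmax_leP; split.
  by rewrite addr_ge0// mulr_ge0// addr_ge0.
move=> l _; rewrite (le_trans (norm2_le_norm _))// ler_wpDr// ler_wpM2l//.
by rewrite (le_trans (ler_normB _ _))// lerD2r.
Qed.

Let eta_bounded : exists2 Be : R, 0 < Be & forall k, eta k <= Be.
Proof.
have [Bm Bm0 muB] := mu_bounded; exists (Bm * r 0%N); first by rewrite mulr_gt0.
by move=> k; rewrite etaE ler_pM ?(ltW (r_gt0 k)) ?(ltW (mu_gt0 k)) ?r_ni.
Qed.

Let momentum_cvg0 (q : R) : (forall k, Q k <= q) -> m @ \oo --> (0 : 'rV[R]_n).
Proof.
move=> Qq; have : cvgn Q.
  by apply: nondecreasing_is_cvgn => //; exists q => _ [k _ <-].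
move=> /cvg_ex[L /cvgrPdist_le QL]; apply/cvgrPdist_le => e e0.
have e2 : 0 < e ^+ 2 / 2 by rewrite divr_gt0// exprn_gt0.
have [k0 _ k0P] := QL _ e2; exists k0.+1 => // -[//|k] /= kk.
rewrite sub0r normrN (le_trans (norm_le_norm2 _))//.
rewrite -ler_sqr ?nnegrE ?norm2_ge0 ?(ltW e0)//.
have := k0P k kk; rewrite /= ler_distl => /andP[? ?].
have := k0P k.+1 (leqW kk); rewrite /= ler_distl QS => /andP[? ?]; lra.
Qed.

Let r_cvg0 : (forall q, exists k, q < Q k) -> r @ \oo --> 0.
Proof.
move=> Qoo; apply/cvgrPdist_le => e e0; have [k0 k0P] := Qoo (e ^- 2).
exists k0 => // k /= kk; rewrite sub0r normrN gtr0_norm// (le_trans (r_ni kk))//.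
rewrite /r -[leRHS]invrK lef_pV2 ?posrE ?sqrtr_gt0 ?invr_gt0//.
rewrite -[leLHS]gtr0_norm ?invr_gt0// -sqrtr_sqr ler_wsqrtr// exprVn ltW//.
Qed.

Let eta_cvg0 : (forall q, exists k, q < Q k) -> eta @ \oo --> 0.
Proof.
move=> /r_cvg0 r0; have [Bm Bm0 muB] := mu_bounded.
have Br : Bm * r k @[k --> \oo] --> 0 by rewrite -(mulr0 Bm); exact: cvgZr.
apply: squeeze_cvgr (cvg_cst 0) Br; apply: nearW => k.
by rewrite (ltW (eta_gt0 k)) etaE ler_wpM2r// ltW.
Qed.

Let Q_dichotomy : (exists q, forall k, Q k <= q) \/ (forall q, exists k, q < Q k).
Proof.
have [|nb] := pselect (exists q, forall k, Q k <= q); [by left | right => q].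
apply: contrapT => nk; apply: nb; exists q => k.
by rewrite leNgt; apply/negP => h; apply: nk; exists k.
Qed.

(** In either case of [Q_dichotomy] one factor of the step vanishes and the other is bounded: the
    momentum vanishes if [Q] is bounded, the step size otherwise. *)
Lemma lfm_step_cvg0 : x k.+1 - x k @[k --> \oo] --> (0 : 'rV[R]_n).
Proof.
have xE k : x k.+1 - x k = - (eta k *: m k.+1) by rewrite x_step addrC addKr.
suff : eta k * `|m k.+1| @[k --> \oo] --> 0.
  move=> h; apply/cvgrPdist_le => e e0; move/cvgrPdist_le : h => /(_ e e0).
  apply: filterS => k; rewrite xE !sub0r !normrN normrM normr_id.
  by rewrite [`|eta k *: _|]normrZ.
have [[q Qq]|Qoo] := Q_dichotomy.
  have [Be Be0 etaB] := eta_bounded.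
  have mS : m k.+1 @[k --> \oo] --> (0 : 'rV[R]_n).
    by rewrite cvg_shiftS; exact: momentum_cvg0 Qq.
  have Bm0 : Be * `|m k.+1| @[k --> \oo] --> 0.
    by rewrite -(mulr0 Be) -(@normr0 _ 'rV[R]_n); apply: cvgZr; exact: cvg_norm.
  apply: squeeze_cvgr (cvg_cst 0) Bm0; apply: nearW => k.
  by rewrite mulr_ge0 ?(ltW (eta_gt0 k))//= ler_wpM2r.
have [C C0 mC] := momentum_bounded.
have eC : eta k * C @[k --> \oo] --> 0.
  by rewrite -(mul0r C); apply: cvgZr_tmp; exact: eta_cvg0.
apply: squeeze_cvgr (cvg_cst 0) eC; apply: nearW => k.
by rewrite mulr_ge0 ?(ltW (eta_gt0 k))//= ler_wpM2l// ltW.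
Qed.

Let drift_small (j : nat) (e : R) : 0 < e -> \forall k \near \oo,
  forall l, (k <= l <= k + j)%N -> `|x l - x k| <= e.
Proof.
move=> e0; have j0 : 0 < j%:R + 1 :> R by rewrite ltr_wpDl.
have e'0 : 0 < e / (j%:R + 1) by rewrite divr_gt0.
move/cvgrPdist_le : lfm_step_cvg0 => /(_ _ e'0) [k0 _ k0P].
exists k0 => // k /= kk l /andP[kl lj].
have drift d : `|x (k + d)%N - x k| <= d%:R * (e / (j%:R + 1)).
  elim: d => [|d IH]; first by rewrite addn0 subrr normr0 mul0r.
  rewrite addnS -(subrK (x (k + d)%N) (x _.+1)) -addrA (le_trans (ler_normD _ _))//.
  rewrite -natr1 mulrDl mul1r [leLHS]addrC lerD//.
  by have := k0P (k + d)%N (leq_trans kk (leq_addr _ _)); rewrite /= sub0r normrN.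
have := drift (l - k)%N; rewrite subnKC// => /le_trans; apply.
rewrite mulrA ler_pdivrMr// mulrC ler_wpM2l ?(ltW e0)//.
by rewrite ler_wpDr// ler_nat; lia.
Qed.

(** Step sizes do not vanish here, so no limit curve is available. But every [i] is sampled soon
    after [k], at an iterate still close to [x k], and [g] tends to 0; graph closedness then puts 0
    in each [D i y]. *)
Let limit_critical_summable (q : R) (U : set_system nat) (y : 'rV[R]_n) : (forall k, Q k <= q) ->
  UltraFilter U -> \oo `<=` U -> x k @[k --> U] --> y -> mean_field D y 0.
Proof.
move=> /momentum_cvg0 m0' UU ooU xy.
have g0 : g @ \oo --> (0 : 'rV[R]_n).
  have -> : g = fun k => (1 - beta)^-1 *: (m k.+1 - beta *: m k).
    apply/funext => k; rewrite m_step addrAC subrr add0r scalerA mulVf ?scale1r//.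
    by rewrite subr_eq0 gt_eqF.
  rewrite -(scaler0 _ (1 - beta)^-1); apply: cvgZr.
  rewrite -[X in _ --> X](subr0 (0 : 'rV[R]_n)) -{2}(scaler0 _ beta).
  apply: cvgB; last by apply: cvgZr.
  by rewrite cvg_shiftS.
suff D0 i : D i y 0.
  have [C C0 DC] := locally_bounded_family lbD `|y|.
  apply: mean_field_zero => // [i z|u].
    exact: conservative_field_nonempty (fD i).
  apply: sumr_ge0 => i _; rewrite -(dot0v u).
  by apply: (le_sup_dot u (C := C)) => // l; exact: DC.
(* Position of [i] in the epoch after that of [k], hence not before [k] and at most [2 * N] steps
   later. *)
pose l k := ((k %/ N).+1 * N + (pi (k %/ N).+1)^-1%g i)%N.
have idxl k : idx (l k) = i.
  have lq : (l k %/ N)%N = (k %/ N).+1.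
    by rewrite /l divnMDl// [(_ %/ N)%N in X in (_ + X)%N]divn_small ?addn0.
  rewrite /idx /reshuffled_index lq.
  rewrite -[RHS](permKV (pi (k %/ N).+1)); congr (pi _ _).
  by apply: val_inj; rewrite /= modnMDl modn_small.
have lk k : (k <= l k <= k + 2 * N)%N.
  have := ltn_ord ((pi (k %/ N).+1)^-1%g i); rewrite /l mulSn.
  have := divn_eq k N; have := ltn_pmod k N_gt0; lia.
have xl : x (l k) @[k --> U] --> y.
  apply/cvgrPdist_le => e e0; have e2 : 0 < e / 2 by rewrite divr_gt0.
  have dr := ooU _ (drift_small (2 * N) e2).
  move/cvgrPdist_le : xy => /(_ _ e2); apply: filterS2 dr => k /(_ _ (lk k)) h1 h2.
  rewrite -(subrK (x k) y) -addrA (le_trans (ler_normD _ _))// [leRHS]splitr.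
  by rewrite lerD// distrC.
have gl : g (l k) @[k --> U] --> (0 : 'rV[R]_n).
  apply/cvgrPdist_le => e e0; move/cvgrPdist_le : g0 => /(_ e e0) [k0 _ k0P].
  apply: ooU; exists k0 => // k /= kk; apply: k0P => /=.
  by have /andP[h _] := lk k; exact: leq_trans h.
apply: (graph_closed_cvg (@cD i) xl gl); apply: nearW => k.
by rewrite -{1}(idxl k); exact: g_in.
Qed.

(** [Q] grows at most linearly and [mu] is nondecreasing, so the step sizes are at least of the
    order of the inverse square root of [k]. *)
Let clock_unbounded (A : R) : exists k, A <= clock eta k.
Proof.
have [C C0 mC] := momentum_bounded.
pose c := eps0 + (n%:R * C) ^+ 2.
have c0 : 0 < c by rewrite ltr_wpDr// sqr_ge0.
have Qc k : Q k <= k.+1%:R * c.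
  rewrite /Q mulrDr lerD//; first by rewrite ler_peMl ?(ltW eps0_gt0)// ler1n.
  rewrite -[X in X%:R * _](card_ord k.+1) mulr_natl -sumr_const.
  apply: ler_sum => l _; rewrite ler_sqr ?nnegrE ?norm2_ge0 ?mulr_ge0 ?(ltW C0)//.
  by rewrite (le_trans (norm2_le_norm _))// ler_wpM2l.
have sc : 0 < Num.sqrt c by rewrite sqrtr_gt0.
have mu0 : 0 < mu 0%N by exact: mu_gt0.
have mu_ge k : mu 0%N <= mu k by elim: k => // k IH; exact: le_trans (muS k).
pose j := (Num.bound `|A * Num.sqrt c / mu 0%N|).+1.
have Aj : A <= j%:R * (mu 0%N / Num.sqrt c).
  rewrite mulrA ler_pdivlMr// -ler_pdivrMr// ltW//.
  by rewrite (le_lt_trans (ler_norm _))// (lt_trans (archi_boundP (normr_ge0 _)))// ltr_nat.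
(* Stopping at a perfect square turns the lower bound into [j] times a constant. *)
exists (j * j)%N; apply: (le_trans Aj).
have j0 : (0 < j * j)%N by [].
rewrite -(prednK j0).
have cl k : k.+1%:R * (mu 0%N * r k) <= clock eta k.+1.
  rewrite /clock -[X in X%:R * _](card_ord k.+1) mulr_natl -sumr_const.
  apply: ler_sum => l _; rewrite etaE ler_pM ?(ltW mu0) ?(ltW (r_gt0 k))//.
  by rewrite r_ni// -ltnS.
apply: le_trans (cl _); rewrite (prednK j0).
have rj : (j%:R * Num.sqrt c)^-1 <= r (j * j).-1.
  rewrite /r lef_pV2 ?posrE ?sqrtr_gt0 ?mulr_gt0//.
  rewrite -[X in X * _]ger0_norm// -sqrtr_sqr -sqrtrM ?sqr_ge0// ler_wsqrtr//.
  by rewrite (le_trans (Qc _))// (prednK j0) natrM expr2.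
apply: (@le_trans _ _ ((j * j)%:R * (mu 0%N * (j%:R * Num.sqrt c)^-1))).
  rewrite natrM le_eqVlt; apply/orP; left; apply/eqP; field.
  by rewrite gt_eqF// pnatr_eq0.
by rewrite ler_wpM2l// ler_wpM2l// ltW.
Qed.

Let limit_critical_divergent (U : set_system nat) (y : 'rV[R]_n) : (forall q, exists k, q < Q k) ->
  UltraFilter U -> \oo `<=` U -> x k @[k --> U] --> y ->
  no_instant_drop x (mean_fun f) U y -> mean_field D y 0.
Proof.
move=> Qoo UU ooU xy [d d0 dP].
have [C C0 mC] := momentum_bounded; have [Bm Bm0 muB] := mu_bounded.
pose V k := r 0%N * mu k - Bm * r k.
have rS k : r k.+1 <= r k by exact: r_ni.
(* mu is nondecreasing and r nonincreasing, so [V] bounds the variation of eta. *)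
have eta_var k : `|eta k.+1 - eta k| <= V k.+1 - V k.
  rewrite !etaE (_ : _ - _ = r k * (mu k.+1 - mu k) - mu k.+1 * (r k - r k.+1)); last by ring.
  have rk0 := ltW (r_gt0 k); have muk0 : 0 <= mu k.+1 by exact/ltW/mu_gt0.
  have dmu : 0 <= mu k.+1 - mu k by rewrite subr_ge0.
  have dr : 0 <= r k - r k.+1 by rewrite subr_ge0.
  have n1 := ger0_norm (mulr_ge0 rk0 dmu); have n2 := ger0_norm (mulr_ge0 muk0 dr).
  apply: (le_trans (ler_normB _ _)); rewrite n1 n2.
  have : r k * (mu k.+1 - mu k) <= r 0%N * (mu k.+1 - mu k).
    by rewrite ler_wpM2r ?subr_ge0// r_ni.
  have : mu k.+1 * (r k - r k.+1) <= Bm * (r k - r k.+1).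
    by rewrite ler_wpM2r ?subr_ge0.
  by rewrite /V; lra.
have V_cvg : cvgn V.
  apply: nondecreasing_is_cvgn.
    by apply/nondecreasing_seqP => i; rewrite -subr_ge0 (le_trans _ (eta_var i)).
  exists (r 0%N * Bm) => _ [k _ <-]; rewrite /V lerBlDr ler_wpDr//.
    by rewrite mulr_ge0// ltW.
  by rewrite ler_wpM2l// ltW.
have eta0 := eta_cvg0 Qoo.
have /choice[b bP] : forall k, exists b : R -> nat, forall t,
    [/\ (k <= b t)%N, t <= clock eta (b t) - clock eta k &
      0 <= t -> exists2 l, (k <= l)%N & clock eta (b t) - clock eta k <= t + eta l].
  move=> k; have /choice[b bP] := clock_reach eta_gt0 clock_unbounded k.
  by exists b.
have [z zP] := limit_curve_exists xM b UU.
have z0 : z 0 = y.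
  exact: (limit_curve0 eta_gt0 eta0 mC x_step UU ooU bP zP xy).
(* Even with the overshoot the elapsed time is at most twice this value, so the iterates move by at
   most [d / 2]; the other half of the radius covers the distance from [x k] to [y]. *)
have T0 : 0 < d / (4 * C) by rewrite divr_gt0// mulr_gt0.
rewrite -z0.
apply: (@limit_curve_critical _ _ _ f D fD z M C (d / (4 * C))) => //.
- exact: (limit_curve_bounded xM UU zP).
- exact: (limit_curve_lip eta_gt0 eta0 mC x_step UU ooU bP zP).
- move=> t u e t0 e0.
  exact: (limit_curve_velocity eta_gt0 eta0 eta_var V_cvg C0 mC x_step UU ooU bP zP
    (@cD) lbD beta_ge0 beta_lt1 m_step g_in (reshuffled_index_mean N_gt0 pi)).
have : mean_fun f y <= mean_fun f (z (d / (4 * C))).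
  apply/ler_addgt0Pl => e e0; rewrite -lerBlDl.
  have Fz := cvg_ultra_F (@continuous_mean_fun) UU (zP (d / (4 * C))).
  apply: cvgr_to_ge Fz _.
  have d2 : 0 < d / 2 by rewrite divr_gt0.
  have xy' : \forall k \near U, `|y - x k| < d / 2 by move/cvgrPdist_lt : xy; exact.
  apply: filterS3 (dP e e0) xy' (elapsed_clock_small eta_gt0 eta0 ooU bP T0).
  move=> k drop xyk /(_ _ (ltW T0))/andP[_ ck]; have [kb _ _] := bP k (d / (4 * C)).
  apply: drop => // l /andP[kl lb].
  rewrite -(subrK (x k) (x l)) -addrA (le_lt_trans (ler_normD _ _))//.
  have := step_dist_le eta_gt0 mC x_step kl; rewrite distrC.
  rewrite distrC in xyk.
  have : C * (clock eta l - clock eta k) <= C * (d / (4 * C) + d / (4 * C)).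
    rewrite ler_wpM2l ?(ltW C0)// (le_trans _ ck)// lerD2r.
    exact: clock_le.
  have -> : C * (d / (4 * C) + d / (4 * C)) = d / 2 by field; rewrite gt_eqF.
  by lra.
by rewrite -z0 /mean_fun ler_pM2l// invr_gt0 ltr0n.
Qed.

Lemma lfm_limit_critical (U : set_system nat) (y : 'rV[R]_n) : UltraFilter U -> \oo `<=` U ->
  x k @[k --> U] --> y -> no_instant_drop x (mean_fun f) U y -> mean_field D y 0.
Proof.
by have [[q Qq]|Qoo] := Q_dichotomy; [move=> *; exact: limit_critical_summable Qq _ _ _
  | exact: limit_critical_divergent].
Qed.

End Pathwise.

Theorem theorem4p3 (R : realType) (n N : nat) (n_ge1 : (1 <= n)%N)
  (N_ge1 : (1 <= N)%N)
  (f : 'I_N -> 'rV[R]_n -> R) (D : 'I_N -> 'rV[R]_n -> set 'rV[R]_n)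
  (f_lipschitz : forall i, locally_lipschitz (f i))
  (f_pathdiff : forall i, path_differentiable (f i))
  (D_conservative : forall i, conservative_field (D i) (f i))
  (critical_values :
    interior [set mean_fun f y | y in stationary (mean_field D)] = set0)
  (f_bounded_below : has_lbound (range (mean_fun f)))
  (d : measure_display) (T : measurableType d) (P : probability T R)
  (pi : nat -> T -> 'S_N)
  (pi_measurable : forall (i : nat) (s : 'S_N), measurable (pi i @^-1` [set s]))
  (eps0 rho beta : R) (eps0_gt0 : 0 < eps0) (rho_gt0 : 0 < rho)
  (beta_ge0 : 0 <= beta) (beta_lt1 : beta < 1)
  (xbar m0 : 'rV[R]_n) (x m g : nat -> T -> 'rV[R]_n)
  (x_lfm : forall w, lfm D eps0 rho beta xbar m0
    (fun i => pi i w) (fun k => x k w) (fun k => m k w) (fun k => g k w))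
  (mu_gt0 : forall w k, 0 < lfm_mu rho xbar (fun l => x l w) k)
  (M : R) (M_gt0 : 0 < M)
  (x_bounded : {ae P, forall w,
    (ereal_sup (range (fun k => (norm2 (x k w))%:E)) <= M%:E)%E}) :
  {ae P, forall w,
    (forall y, cluster ((fun k => x k w) @ \oo) y ->
       stationary (mean_field D) y) /\
    cvgn (fun k => mean_fun f (x k w))}.
Proof.
apply: filterS x_bounded => w sup_le.
have xM k : `|x k w| <= M.
  rewrite (le_trans (norm_le_norm2 _))// -lee_fin (le_trans _ sup_le)//.
  by apply: ereal_sup_ubound; exists k.
have mu0 := mu_gt0 w; have lfm_w := x_lfm w.
apply: (@no_instant_drop_conclusion _ _ (fun k => x k w) (mean_fun f)
  (stationary (mean_field D)) M xM).
- exact: continuous_mean_fun D_conservative.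
- exact: (lfm_step_cvg0 N_ge1 D_conservative eps0_gt0 rho_gt0 beta_ge0 beta_lt1
    lfm_w mu0 xM).
- exact: (lfm_limit_critical N_ge1 D_conservative eps0_gt0 rho_gt0 beta_ge0 beta_lt1
    lfm_w mu0 xM).
- exact: critical_values.
Qed.
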